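(* The map $$\beta\in\mathscr N\longmapsto(\mathsf{uhf}((\beta(n))_{n\in\mathbb N}),\mathsf L^{\mathscr N}_\beta),$$ where $\mathscr N$ is the Baire space and $\mathsf L^{\mathscr N}_\beta$ is a strongly Leibniz L-seminorm on $\mathsf{uhf}((\beta(n))_{n\in\mathbb N})$ (with $(A,B,C)=(1,0,1)$) satisfying $$\mathsf{\Lambda}^\ast_{SL}((\mathcal V_n^\beta,\mathsf L^{\mathscr N}_{\beta,n}),(\mathsf{uhf}((\beta(n))_{n\in\mathbb N}),\mathsf L^{\mathscr N}_\beta))\leq4\sum_{j=n}^\infty\gamma_\beta(j)\quad\text{for all }n\in\mathbb N,$$ is continuous with respect to the Baire space topology and the topology induced by $\mathsf{\Lambda}^\ast_{SL}$.
   Context: $\mathbb N=\{0,1,2,\dots\}$. Quantum compact metric space with $(A,B)=(1,0)$: a pair $(\mathfrak A,\mathsf L)$ of a unital C*-algebra $\mathfrak A$ (with self-adjoint part $\mathfrak{sa}(\mathfrak A)$, invertible group $\mathrm{GL}(\mathfrak A)$, state space $\mathscr S(\mathfrak A)$) and a seminorm $\mathsf L$ (an L-seminorm) defined on a dense Jordan-Lie subalgebra $\mathrm{dom}(\mathsf L)$ of $\mathfrak{sa}(\mathfrak A)$ (a real subspace closed under $(ab+ba)/2$ and $(ab-ba)/(2i)$) such that: (1) $\{a\in\mathrm{dom}(\mathsf L):\mathsf L(a)=0\}=\mathbb R 1_{\mathfrak A}$; (2) $\mathsf{mk}_{\mathsf L}(\varphi,\psi)=\sup\{|\varphi(a)-\psi(a)|:a\in\mathrm{dom}(\mathsf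 L),\ \mathsf L(a)\leq 1\}$ metrizes the weak* topology of $\mathscr S(\mathfrak A)$; (3) for all $a,b\in\mathrm{dom}(\mathsf L)$, $\max\{\mathsf L(\frac{ab+ba}{2}),\mathsf L(\frac{ab-ba}{2i})\}\leq \mathsf L(a)\|b\|_{\mathfrak A}+\|a\|_{\mathfrak A}\mathsf L(b)$; (4) $\{a\in\mathrm{dom}(\mathsf L):\mathsf L(a)\leq 1\}$ is closed in $\mathfrak A$. It is strongly Leibniz (with $C=1$) if for all $a\in\mathrm{dom}(\mathsf L)\cap\mathrm{GL}(\mathfrak A)$, $a^{-1}\in\mathrm{dom}(\mathsf L)$ and $\mathsf L(a^{-1})\leq\|a^{-1}\|_{\mathfrak A}^2\mathsf L(a)$. Seminorms given on all of a finite-dimensional C*-algebra are restricted to its self-adjoint part. A quantum isometry $\pi:(\mathfrak A,\mathsf L_{\mathfrak A})\to(\mathfrak B,\mathsf L_{\mathfrak B})$ is a surjective *-morphism with $\pi(\mathrm{dom}(\mathsf L_{\mathfrak A}))\subseteq\mathrm{dom}(\mathsf L_{\mathfrak B})$ and $\mathsf L_{\mathfrak B}(b)=\inf\{\mathsf L_{\mathfrak A}(a):a\in\mathrm{dom}(\mathsf L_{\mathfrak A}),\pi(a)=b\}$ for all $b\in\mathrm{dom}(\mathsf L_{\mathfrak B})$. A tunnel $(\mathfrak D,\mathsf L_{\mathfrak D},\pi_1,\pi_2)$ from $(\mathfrak A_1,\mathsf L_1)$ to $(\mathfrak A_2,\mathsf L_2)$ is a quantum compact metric space $(\mathfrak D,\mathsf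 L_{\mathfrak D})$ with quantum isometries $\pi_j:(\mathfrak D,\mathsf L_{\mathfrak D})\to(\mathfrak A_j,\mathsf L_j)$; its extent is $\max_{j\in\{1,2\}}\mathsf{Haus}_{\mathsf{mk}_{\mathsf L_{\mathfrak D}}}(\mathscr S(\mathfrak D),\{\varphi\circ\pi_j:\varphi\in\mathscr S(\mathfrak A_j)\})$ ($\mathsf{Haus}$ the Hausdorff distance). $\mathsf{\Lambda}^\ast_{SL}$ between two strongly Leibniz quantum compact metric spaces ($(A,B,C)=(1,0,1)$) is the infimum of extents of tunnels between them with $(\mathfrak D,\mathsf L_{\mathfrak D})$ strongly Leibniz ($(A,B,C)=(1,0,1)$); it is a metric up to full quantum isometry ( *-isomorphism $\pi$ such that $\pi$ and $\pi^{-1}$ are quantum isometries). Baire space: $\mathscr N=(\mathbb N\setminus\{0\})^{\mathbb N}$ with metric $d_{\mathscr N}(x,y)=0$ if $x=y$ and $2^{-\min\{n\in\mathbb N:x(n)\neq y(n)\}}$ otherwise. UHF algebras. For $\beta=(\beta(n))_{n\in\mathbb N}\in\mathscr N$ let $\boxtimes\beta(0)=1$ and $\boxtimes\beta(n)=\prod_{j=0}^{n-1}(\beta(j)+1)$ for $n\ge1$. Let $\mu_{\beta,n}:M_{\boxtimes\beta(n)}(\mathbb C)\to M_{\boxtimes\beta(n+1)}(\mathbb C)$, $a\mapsto\mathrm{diag}(a,\ldots,a)$ ($\beta(n)+1$ copies), and $\mathsf{uhf}((\beta(n))_{n\in\mathbb N})=\varinjlim(M_{\boxtimes\beta(n)}(\mathbb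 C),\mu_{\beta,n})_{n\in\mathbb N}$, with canonical unital *-monomorphisms $\mu_\beta^{(n)}:M_{\boxtimes\beta(n)}(\mathbb C)\to\mathsf{uhf}((\beta(n))_{n\in\mathbb N})$. Put $\gamma_\beta(n)=1/\dim(M_{\boxtimes\beta(n)}(\mathbb C))$, let $\rho_\beta$ be the unique faithful tracial state on $\mathsf{uhf}((\beta(n))_{n\in\mathbb N})$, and $\mathcal V_n^\beta=\mu_\beta^{(n)}(M_{\boxtimes\beta(n)}(\mathbb C))$. Constants. Let $\rho_{\beta,n+1}$ be the unique faithful tracial state on $M_{\boxtimes\beta(n+1)}(\mathbb C)$ and $E^{\rho_{\beta,n}}:M_{\boxtimes\beta(n+1)}(\mathbb C)\to\mu_{\beta,n}(M_{\boxtimes\beta(n)}(\mathbb C))$ the unique faithful $\rho_{\beta,n+1}$-preserving conditional expectation. For any faithful conditional expectation $E$, $\|a\|_E=\sqrt{\|E(a^*a)\|}$. For each $\beta,n$ fix any $\lambda_n^\beta>0$ such that $\lambda_n^\beta\|a\|_{M_{\boxtimes\beta(n+1)}(\mathbb C)}\leq\|a\|_{E^{\rho_{\beta,n}}}$ for all $a\in M_{\boxtimes\beta(n+1)}(\mathbb C)$, chosen to depend only on $M_{\boxtimes\beta(n+1)}(\mathbb C)$ (for each $n$, $\lambda_n^\beta=\lambda_n^\eta$ whenever $\boxtimes\beta(n+1)=\boxtimes\eta(n+1)$). Seminorms. Let $E_m^{\rho_\beta}:\mathsf{uhf}((\beta(n))_{n\in\mathbb N})\to\mathcal V_m^\beta$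 be the unique $\rho_\beta$-preserving faithful conditional expectation. For $n\geq1$ and $a\in\mathcal V_n^\beta$ let $$\mathsf L^{\mathscr N}_{\beta,n}(a)=\max_{m\in\{0,\ldots,n-1\}}\frac{\max\{\|a-E_m^{\rho_\beta}(a)\|_{E_m^{\rho_\beta}},\|a^*-E_m^{\rho_\beta}(a^* )\|_{E_m^{\rho_\beta}}\}}{\lambda_m^\beta\gamma_\beta(m)},$$ and $\mathsf L^{\mathscr N}_{\beta,0}=0$. An $\mathsf L^{\mathscr N}_\beta$ with the property required in the claim exists for each $\beta$, and that property determines $(\mathsf{uhf}((\beta(n))_{n\in\mathbb N}),\mathsf L^{\mathscr N}_\beta)$ up to full quantum isometry. *)

(* Defs.v *)
From HB Require Import structures.
From mathcomp Require Import all_boot all_order all_algebra.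
From mathcomp Require Import complex ring.
From mathcomp Require Import all_classical all_reals all_analysis.
Set Implicit Arguments. Unset Strict Implicit. Unset Printing Implicit Defensive.
Import Order.TTheory GRing.Theory Num.Theory.
Import numFieldNormedType.Exports.
Import ComplexField.Normc.
Local Open Scope classical_set_scope.
Local Open Scope ring_scope.
Local Open Scope complex_scope.

HB.mixin Record Algebra_isCstarNormed (R : realType) A
    & GRing.Algebra R[i] A := {
  star : A -> A;
  starD : {morph star : a b / a + b};
  starZ : forall (c : R[i]) (a : A), star (c *: a) = c^* *: star a;
  starM : forall a b : A, star (a * b) = star b * star a;
  starK : involutive star;
  cnorm : A -> R;
  cnormD : forall a b : A, cnorm (a + b) <= cnorm a + cnorm b;
  cnormZ : forall (c : R[i]) (a : A), cnorm (c *: a) = normc c * cnorm a;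
  cnorm0_eq0 : forall a : A, cnorm a = 0 -> a = 0;
  cnormM : forall a b : A, cnorm (a * b) <= cnorm a * cnorm b;
  cnorm_starM : forall a : A, cnorm (star a * a) = cnorm a ^+ 2
}.
#[short(type="preCstarAlgType")]
HB.structure Definition PreCstarAlgebra (R : realType) :=
  {A of Algebra_isCstarNormed R A & GRing.Algebra R[i] A}.

(* HB rejects a join of rings with normed modules (missing join below
   [Num.NumDomain]), so the norm topology of a C*-algebra lives on this alias,
   a real normed space. *)
Definition realnormed (R : realType) (A : preCstarAlgType R) : Type := A.

Section realnormed.
Variables (R : realType) (A : preCstarAlgType R).
HB.instance Definition _ := GRing.Zmodule.on (realnormed A).

Definition rscale (t : R) (a : realnormed A) : realnormed A := t%:C *: (a : A).
Lemma rscaleA s t a : rscale s (rscale t a) = rscale (s * t) a.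
Proof. by rewrite /rscale scalerA -rmorphM. Qed.
Lemma rscale1 : left_id 1 rscale.
Proof. by move=> a; rewrite /rscale rmorph1 scale1r. Qed.
Lemma rscaleDr : right_distributive rscale +%R.
Proof. by move=> t a b; rewrite /rscale scalerDr. Qed.
Lemma rscaleDl a : {morph rscale^~ a : s t / s + t}.
Proof. by move=> s t; rewrite /rscale rmorphD scalerDl. Qed.
HB.instance Definition _ := GRing.Zmodule_isLmodule.Build R (realnormed A)
  rscaleA rscale1 rscaleDr rscaleDl.
Lemma rnormZ (t : R) (a : realnormed A) :
  cnorm (t *: a : A) = `|t| * cnorm (a : A).
Proof.
by rewrite [LHS]cnormZ /= expr0n addr0 sqrtr_sqr.
Qed.
HB.instance Definition _ := Lmodule_isNormed.Build R (realnormed A)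
  (@cnormD R A) rnormZ (@cnorm0_eq0 R A).
End realnormed.

HB.mixin Record PreCstar_isComplete (R : realType) A & PreCstarAlgebra R A := {
  cnorm_complete : forall F : set_system (realnormed A),
    ProperFilter F -> cauchy F -> cvg F
}.
#[short(type="cstarAlgType")]
HB.structure Definition CstarAlgebra (R : realType) :=
  {A of PreCstar_isComplete R A & PreCstarAlgebra R A}.

HB.instance Definition _ (R : realType) (A : cstarAlgType R) :=
  Uniform_isComplete.Build (realnormed A) (@cnorm_complete R A).

Section operator_norm.
Variable R : realType.
Local Notation C := R[i].

Lemma normc_ge0 (z : C) : 0 <= normc z.
Proof. by case: z => a b; exact: sqrtr_ge0. Qed.

Lemma normcE (z : C) : (normc z)%:C = `|z|.
Proof. by case: z. Qed.

Lemma ler_normcD (z w : C) : normc (z + w) <= normc z + normc w.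
Proof. by rewrite -lecR rmorphD /= !normcE ler_normD. Qed.

Lemma normc_conj (z : C) : normc z^* = normc z.
Proof. by case: z => a b /=; rewrite sqrrN. Qed.

Lemma normc_le (z : C) : normc z <= `|complex.Re z| + `|complex.Im z|.
Proof.
case: z => a b /=.
rewrite -(@ler_pXn2r _ 2) ?nnegrE ?sqrtr_ge0 ?addr_ge0//.
rewrite sqr_sqrtr ?addr_ge0 ?sqr_ge0// sqrrD !real_normK ?num_real//.
by rewrite lerD2r lerDl mulrn_wge0// mulr_ge0.
Qed.

Lemma normc_mulJ (z : C) : z^* * z = (normc z ^+ 2)%:C.
Proof.
case: z => a b; rewrite /= sqr_sqrtr ?addr_ge0 ?sqr_ge0//.
by apply/eqP; rewrite eq_complex /= mulNr opprK !expr2 mulNr [b * a]mulrC subrr !eqxx.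
Qed.

Lemma ler_normc_sum I (r : seq I) (F : I -> C) :
  normc (\sum_(i <- r) F i) <= \sum_(i <- r) normc (F i).
Proof.
elim: r => [|i r IH]; first by rewrite !big_nil normc0.
by rewrite !big_cons (le_trans (ler_normcD _ _))// lerD2l.
Qed.

Definition l2norm n (x : 'cV[C]_n) : R :=
  Num.sqrt (\sum_i normc (x i 0) ^+ 2).

Definition opnorm m n (a : 'M[C]_(m, n)) : R :=
  sup [set l2norm (a *m x) | x in [set x | l2norm x <= 1]].

Let mulr_le_sqr (u v s t : R) : 0 < s -> 0 < t ->
  u * v <= s * t / 2 * ((u / s) ^+ 2 + (v / t) ^+ 2).
Proof.
move=> s0 t0; rewrite -subr_ge0.
have -> : s * t / 2 * ((u / s) ^+ 2 + (v / t) ^+ 2) - u * v =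
    s * t / 2 * (u / s - v / t) ^+ 2 by field; rewrite !gt_eqF.
by rewrite mulr_ge0 ?sqr_ge0// divr_ge0// ltW// mulr_gt0.
Qed.

Section l2.
Variable n : nat.
Implicit Types x y : 'cV[C]_n.

Lemma l2norm_ge0 x : 0 <= l2norm x. Proof. exact: sqrtr_ge0. Qed.

Lemma l2norm_sqr x : l2norm x ^+ 2 = \sum_i normc (x i 0) ^+ 2.
Proof. by rewrite sqr_sqrtr// sumr_ge0// => i _; exact: sqr_ge0. Qed.

Lemma l2norm0 : l2norm (0 : 'cV[C]_n) = 0.
Proof.
by rewrite /l2norm big1 ?sqrtr0// => i _; rewrite mxE normc0 expr0n.
Qed.

Lemma l2normZ (c : C) x : l2norm (c *: x) = normc c * l2norm x.
Proof.
rewrite /l2norm -[in RHS](ger0_norm (normc_ge0 c)) -sqrtr_sqr -sqrtrM ?sqr_ge0//.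
by congr Num.sqrt; rewrite mulr_sumr; apply: eq_bigr => i _; rewrite mxE normcM exprMn.
Qed.

Lemma normc_l2norm x i : normc (x i 0) <= l2norm x.
Proof.
rewrite -[leLHS]ger0_norm ?normc_ge0// -sqrtr_sqr ler_wsqrtr//.
by rewrite (bigD1 i)//= lerDl sumr_ge0// => j _; exact: sqr_ge0.
Qed.

Lemma l2norm_eq0 x : l2norm x = 0 -> x = 0.
Proof.
move=> x0; apply/matrixP => i j; rewrite ord1 mxE; apply: eq0_normc.
by apply/eqP; rewrite eq_le normc_ge0 andbT -x0 normc_l2norm.
Qed.

Lemma l2norm_cauchy x y :
  \sum_i normc (x i 0) * normc (y i 0) <= l2norm x * l2norm y.
Proof.
have [x0|x0] := eqVneq (l2norm x) 0.
  rewrite x0 mul0r big1// => i _.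
  by rewrite (l2norm_eq0 x0) mxE normc0 mul0r.
have [y0|y0] := eqVneq (l2norm y) 0.
  rewrite y0 mulr0 big1// => i _.
  by rewrite (l2norm_eq0 y0) mxE normc0 mulr0.
have px : 0 < l2norm x by rewrite lt_def x0 l2norm_ge0.
have py : 0 < l2norm y by rewrite lt_def y0 l2norm_ge0.
rewrite (@le_trans _ _ (\sum_i (l2norm x * l2norm y / 2 *
   ((normc (x i 0) / l2norm x) ^+ 2 + (normc (y i 0) / l2norm y) ^+ 2))))//.
  by apply: ler_sum => i _; exact: mulr_le_sqr.
rewrite -mulr_sumr big_split/=.
under eq_bigr do rewrite exprMn.
under [X in _ + X]eq_bigr do rewrite exprMn.
rewrite -!mulr_suml -!l2norm_sqr -!exprMn !divff// expr1n.
by rewrite -[1 + 1]/2%:R divfK.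
Qed.

Lemma l2normD x y : l2norm (x + y) <= l2norm x + l2norm y.
Proof.
rewrite -(@ler_pXn2r _ 2) ?nnegrE ?addr_ge0 ?l2norm_ge0//.
rewrite l2norm_sqr sqrrD !l2norm_sqr.
rewrite (@le_trans _ _ (\sum_i (normc (x i 0) + normc (y i 0)) ^+ 2))//.
  apply: ler_sum => i _; rewrite mxE ler_pXn2r ?nnegrE ?addr_ge0 ?normc_ge0//.
  exact: ler_normcD.
under eq_bigr do rewrite sqrrD.
by rewrite !big_split/= lerD2r lerD2l mulr2n lerD ?l2norm_cauchy.
Qed.

Lemma l2norm_le_sum x : l2norm x <= \sum_i normc (x i 0).
Proof.
rewrite -(@ler_pXn2r _ 2) ?nnegrE ?l2norm_ge0 ?sumr_ge0//; last first.
  by move=> i _; exact: normc_ge0.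
rewrite l2norm_sqr [leRHS]expr2 mulr_suml; apply: ler_sum => i _.
rewrite expr2 ler_wpM2l ?normc_ge0// (bigD1 i)//= lerDl sumr_ge0// => j _.
exact: normc_ge0.
Qed.

End l2.

Section opnorm.
Variables m n : nat.
Implicit Types a b : 'M[C]_(m, n).

Definition sumnorm a : R := \sum_i \sum_j normc (a i j).

Lemma l2norm_mul_sumnorm a x : l2norm (a *m x) <= sumnorm a * l2norm x.
Proof.
rewrite (le_trans (l2norm_le_sum _))// mulr_suml; apply: ler_sum => i _.
rewrite mxE (le_trans (ler_normc_sum _ _))// mulr_suml.
apply: ler_sum => j _; rewrite normcM ler_wpM2l ?normc_ge0//.
exact: normc_l2norm.
Qed.

Lemma sumnorm_ge0 a : 0 <= sumnorm a.
Proof. by do 2 (apply: sumr_ge0 => ? _); exact: normc_ge0. Qed.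

Lemma has_sup_opnorm a :
  has_sup [set l2norm (a *m x) | x in [set x | l2norm x <= 1]].
Proof.
split; first by exists (l2norm (a *m 0)), 0 => //=; rewrite l2norm0.
exists (sumnorm a) => _ [x /= x1 <-].
rewrite (le_trans (l2norm_mul_sumnorm _ _))//.
by rewrite -[leRHS]mulr1 ler_wpM2l ?sumnorm_ge0.
Qed.

Lemma opnorm_ge0 a : 0 <= opnorm a.
Proof.
apply: (le_trans (l2norm_ge0 (a *m 0))).
by apply: sup_upper_bound; [exact: has_sup_opnorm|exists 0; rewrite //= l2norm0].
Qed.

Lemma l2norm_mul a x : l2norm (a *m x) <= opnorm a * l2norm x.
Proof.
have [x0|x0] := eqVneq (l2norm x) 0.
  by rewrite (l2norm_eq0 x0) mulmx0 !l2norm0 mulr0.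
have px : 0 < l2norm x by rewrite lt_def x0 l2norm_ge0.
have nV : normc ((l2norm x)^-1%:C) = (l2norm x)^-1.
  by rewrite /= expr0n addr0 sqrtr_sqr ger0_norm// invr_ge0 ltW.
rewrite -ler_pdivrMr// mulrC -nV -l2normZ scalemxAr.
apply: sup_upper_bound; first exact: has_sup_opnorm.
by exists ((l2norm x)^-1%:C *: x) => //=; rewrite l2normZ nV mulVf.
Qed.

Lemma opnorm_le a K : 0 <= K -> (forall x, l2norm (a *m x) <= K * l2norm x) ->
  opnorm a <= K.
Proof.
move=> K0 aK; apply: ge_sup; first by case: (has_sup_opnorm a).
move=> _ [x /= x1 <-]; rewrite (le_trans (aK x))//.
by rewrite -[leRHS]mulr1 ler_wpM2l.
Qed.

Lemma opnorm_le_sum a : opnorm a <= sumnorm a.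
Proof. by apply: opnorm_le; [exact: sumnorm_ge0|exact: l2norm_mul_sumnorm]. Qed.

Lemma opnormD a b : opnorm (a + b) <= opnorm a + opnorm b.
Proof.
apply: opnorm_le => [|x]; first by rewrite addr_ge0 ?opnorm_ge0.
by rewrite mulmxDl (le_trans (l2normD _ _))// mulrDl lerD ?l2norm_mul.
Qed.

Lemma opnorm_leZ c a : opnorm (c *: a) <= normc c * opnorm a.
Proof.
apply: opnorm_le => [|x]; first by rewrite mulr_ge0 ?normc_ge0 ?opnorm_ge0.
by rewrite -scalemxAl l2normZ -mulrA ler_wpM2l ?normc_ge0 ?l2norm_mul.
Qed.

Lemma normc_opnorm a i j : normc (a i j) <= opnorm a.
Proof.
have e1 : l2norm (delta_mx j 0 : 'cV[C]_n) = 1.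
  have -> : l2norm (delta_mx j 0 : 'cV[C]_n) = Num.sqrt (normc (1 : C) ^+ 2).
    rewrite /l2norm (bigD1 j)// mxE !eqxx big1 => [|k /negPf kj].
      by rewrite [X in Num.sqrt X]addr0.
    by rewrite mxE kj andFb normc0 expr0n.
  by rewrite normc1 expr1n sqrtr1.
have := l2norm_mul a (delta_mx j 0); rewrite e1 mulr1; apply: le_trans.
by apply: le_trans (normc_l2norm _ i); rewrite -colE mxE.
Qed.

Lemma opnorm_eq0 a : opnorm a = 0 -> a = 0.
Proof.
move=> a0; apply/matrixP => i j; rewrite mxE; apply: eq0_normc.
by apply/eqP; rewrite eq_le normc_ge0 andbT -a0 normc_opnorm.
Qed.

End opnorm.

Lemma opnormZ m n c (a : 'M[C]_(m, n)) : opnorm (c *: a) = normc c * opnorm a.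
Proof.
have [->|c0] := eqVneq c 0.
  rewrite normc0 mul0r scale0r; apply/eqP; rewrite eq_le opnorm_ge0 andbT.
  by apply: opnorm_le => // x; rewrite mul0mx l2norm0 mul0r.
have pc : 0 < normc c.
  by rewrite lt_def normc_ge0 andbT; apply: contra c0 => /eqP/eq0_normc ->.
apply/eqP; rewrite eq_le opnorm_leZ/= mulrC -ler_pdivlMr// mulrC -normcV.
by rewrite -[X in opnorm X <= _](scalerK c0) opnorm_leZ.
Qed.

Lemma opnormM m n p (a : 'M[C]_(m, n)) (b : 'M[C]_(n, p)) :
  opnorm (a *m b) <= opnorm a * opnorm b.
Proof.
apply: opnorm_le => [|x]; first by rewrite mulr_ge0 ?opnorm_ge0.
rewrite -mulmxA (le_trans (l2norm_mul _ _))// -mulrA.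
by rewrite ler_wpM2l ?opnorm_ge0 ?l2norm_mul.
Qed.

Definition adjmx m n (a : 'M[C]_(m, n)) : 'M[C]_(n, m) := map_mx conjc a^T.

Lemma adjmxK m n (a : 'M[C]_(m, n)) : adjmx (adjmx a) = a.
Proof. by apply/matrixP => i j; rewrite !mxE conjcK. Qed.

Lemma adjmxM m n p (a : 'M[C]_(m, n)) (b : 'M[C]_(n, p)) :
  adjmx (a *m b) = adjmx b *m adjmx a.
Proof. by rewrite /adjmx trmx_mul map_mxM. Qed.

Lemma adjmx_cV n (x : 'cV[C]_n) : (adjmx x *m x) 0 0 = (l2norm x ^+ 2)%:C.
Proof.
rewrite mxE l2norm_sqr rmorph_sum; apply: eq_bigr => i _.
by rewrite !mxE normc_mulJ.
Qed.

Lemma opnorm_adj_le m n (a : 'M[C]_(m, n)) :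
  opnorm a ^+ 2 <= opnorm (adjmx a *m a).
Proof.
set K := opnorm (adjmx a *m a).
have K0 : 0 <= K by exact: opnorm_ge0.
rewrite -(@ler_sqrt _ _ K)// sqrtr_sqr ger0_norm ?opnorm_ge0//.
apply: opnorm_le => [|x]; first exact: sqrtr_ge0.
rewrite -(@ler_pXn2r _ 2) ?nnegrE ?mulr_ge0 ?sqrtr_ge0 ?l2norm_ge0//.
rewrite exprMn (@sqr_sqrtr _ K)//.
have -> : l2norm (a *m x) ^+ 2 = normc ((adjmx x *m (adjmx a *m a *m x)) 0 0).
  rewrite -mulmxA mulmxA -adjmxM adjmx_cV /= expr0n addr0 sqrtr_sqr.
  by rewrite ger0_norm// sqr_ge0.
rewrite mxE (le_trans (ler_normc_sum _ _))//.
under eq_bigr do rewrite normcM 2!mxE normc_conj.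
rewrite (le_trans (l2norm_cauchy _ _))// expr2 mulrCA.
by rewrite ler_wpM2l ?l2norm_ge0// l2norm_mul.
Qed.

Lemma opnorm_le_adj m n (a : 'M[C]_(m, n)) : opnorm a <= opnorm (adjmx a).
Proof.
have [a0|a0] := eqVneq (opnorm a) 0; first by rewrite a0 opnorm_ge0.
have pa : 0 < opnorm a by rewrite lt_def a0 opnorm_ge0.
rewrite -(ler_pM2r pa) -expr2 (le_trans (opnorm_adj_le _))//.
exact: opnormM.
Qed.

Lemma opnorm_adjM m n (a : 'M[C]_(m, n)) :
  opnorm (adjmx a *m a) = opnorm a ^+ 2.
Proof.
apply/eqP; rewrite eq_le opnorm_adj_le andbT (le_trans (opnormM _ _))//.
rewrite expr2 ler_wpM2r ?opnorm_ge0//.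
by have := opnorm_le_adj (adjmx a); rewrite adjmxK.
Qed.

Section matrix_cstar.
Variable k : nat.
Local Notation M := 'M[C]_k.+1.

Lemma adjmxD : {morph @adjmx k.+1 k.+1 : a b / a + b}.
Proof. by move=> a b; apply/matrixP => i j; rewrite !mxE rmorphD. Qed.

Lemma adjmxZ (c : C) (a : M) : adjmx (c *: a) = c^* *: adjmx a.
Proof. by apply/matrixP => i j; rewrite !mxE rmorphM. Qed.

HB.instance Definition _ := Algebra_isCstarNormed.Build R M
  adjmxD adjmxZ (@adjmxM _ _ _) (@adjmxK _ _)
  (@opnormD _ _) (@opnormZ _ _) (@opnorm_eq0 _ _) (@opnormM _ _ _)
  (@opnorm_adjM _ _).

Lemma opnorm_complete (F : set_system (realnormed M)) :
  ProperFilter F -> cauchy F -> cvg F.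
Proof.
move=> FF /cauchy_ballP Fc.
pose p (f : C -> R) i j : realnormed M -> R := fun a => f ((a : M) i j).
have cv (f : C -> R) i j : (forall z w, f z - f w = f (z - w)) ->
    (forall z, `|f z| <= normc z) -> cvg (p f i j @ F).
  move=> fB fn; have FpF : ProperFilter (p f i j @ F) by exact: fmap_proper_filter.
  apply: R_complete; have [+ _] := @cauchy_ballP R R (p f i j @ F) _.
  apply=> e e0.
  have [[P Q] /= [FP FQ] PQ] := Fc _ e0.
  exists (p f i j @` P, p f i j @` Q) => /=.
    by split; [apply: filterS FP|apply: filterS FQ] => a ?; exists a.
  move=> [_ _] /= [[a Pa <-] [b Qb <-]].
  have /= := PQ (a, b) (conj Pa Qb); rewrite -ball_normE /= => ab.
  rewrite -ball_normE /ball_/= /p fB (le_lt_trans (fn _))//; apply: le_lt_trans ab.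
  have := normc_opnorm ((a : M) - (b : M)) i j.
  by rewrite !mxE.
have Re_le (z : C) : `|complex.Re z| <= normc z.
  by case: z => a b /=; rewrite -sqrtr_sqr ler_wsqrtr// lerDl sqr_ge0.
have Im_le (z : C) : `|complex.Im z| <= normc z.
  by case: z => a b /=; rewrite -sqrtr_sqr ler_wsqrtr// lerDr sqr_ge0.
have ReB (z w : C) : complex.Re z - complex.Re w = complex.Re (z - w) by case: z w => [? ?] [].
have ImB (z w : C) : complex.Im z - complex.Im w = complex.Im (z - w) by case: z w => [? ?] [].
have cR i j := cv _ i j ReB Re_le.
have cI i j := cv _ i j ImB Im_le.
pose l : M := \matrix_(i, j) (lim (p (@complex.Re R) i j @ F) +i* lim (p (@complex.Im R) i j @ F)).
apply/cvg_ex; exists (l : realnormed M).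
apply/cvgrPdist_lt => e e0.
pose N : R := (k.+1 * k.+1)%:R.
have N0 : 0 < N by rewrite ltr0n.
pose d : R := e / (2 * N).
have d0 : 0 < d by rewrite divr_gt0// mulr_gt0.
have nR : \forall a \near F, forall i j,
    `|lim (p (@complex.Re R) i j @ F) - complex.Re ((a : M) i j)| < d /\
    `|lim (p (@complex.Im R) i j @ F) - complex.Im ((a : M) i j)| < d.
  apply: filter_forall => i; apply: filter_forall => j; apply: filterI.
    by have /cvgrPdist_lt/(_ d d0) := cR i j.
  by have /cvgrPdist_lt/(_ d d0) := cI i j.
apply: filterS nR => a aP.
rewrite -[ltLHS]/(opnorm (l - (a : M))).
apply: (le_lt_trans (opnorm_le_sum _)).
have -> : e = \sum_(i < k.+1) \sum_(j < k.+1) (2 * d).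
  rewrite !sumr_const !card_ord -mulrnA -mulr_natr -/N /d.
  by field; rewrite gt_eqF.
have entry i j : normc ((l - (a : M)) i j) < 2 * d.
  have [aR aI] := aP i j.
  rewrite mulr_natl mulr2n (le_lt_trans (normc_le _))// ltrD//.
    by rewrite mxE [X in _ + X]mxE -ReB mxE.
  by rewrite mxE [X in _ + X]mxE -ImB mxE.
have hasT : has predT (index_enum 'I_k.+1).
  by apply/hasP; exists ord0; rewrite ?mem_index_enum.
apply: ltr_sum => // i _; apply: ltr_sum => // j _; exact: entry.
Qed.

HB.instance Definition _ := PreCstar_isComplete.Build R M opnorm_complete.

End matrix_cstar.
End operator_norm.

Definition star_preserving (R : realType) (A B : cstarAlgType R)
    (f : {lrmorphism A -> B}) : Prop :=
  forall a, f (star a) = star (f a).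

Record state (R : realType) (A : cstarAlgType R) := State {
  state_fun :> {scalar A};
  state_ge0 : forall a, 0 <= state_fun (star a * a);
  state1 : state_fun 1 = 1
}.

Section state_space.
Variables (R : realType) (A : cstarAlgType R).

HB.instance Definition _ := gen_eqMixin (state A).
HB.instance Definition _ := gen_choiceMixin (state A).

Definition state_eval (phi : state A) : {ptws A -> R[i]^o} := phi.

(* The weak* topology is that of pointwise convergence on A. *)
HB.instance Definition _ :=
  Topological.copy (state A) (initial_topology state_eval).

End state_space.

Section pullback.
Variables (R : realType) (A B : cstarAlgType R).
Variables (f : {lrmorphism A -> B}) (fs : star_preserving f) (phi : state B).

Definition pullback_fun (a : A) : R[i] := phi (f a).

Lemma pullback_is_linear : scalar pullback_fun.
Proof. by move=> c a b; rewrite /pullback_fun !linearP. Qed.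
HB.instance Definition _ :=
  GRing.isLinear.Build R[i] A R[i] *%R pullback_fun pullback_is_linear.

Lemma pullback_ge0 a : 0 <= pullback_fun (star a * a).
Proof. by rewrite /pullback_fun rmorphM /= fs state_ge0. Qed.

Lemma pullback1 : pullback_fun 1 = 1.
Proof. by rewrite /pullback_fun rmorph1 state1. Qed.

Definition pullback : state A := State pullback_ge0 pullback1.

End pullback.

Definition selfadjoint (R : realType) (A : cstarAlgType R) : set A :=
  [set a | star a = a].

Definition jordan (R : realType) (A : cstarAlgType R) (a b : A) : A :=
  (2^-1 : R[i]) *: (a * b + b * a).

Definition lie (R : realType) (A : cstarAlgType R) (a b : A) : A :=
  ((2 * 'i)^-1 : R[i]) *: (a * b - b * a).

(* No axioms: [lip] is only meaningful on [lipdom]. *)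
Record lipPair (R : realType) := LipPair {
  lipalg :> cstarAlgType R;
  lipdom : set lipalg;
  lip : lipalg -> R
}.
Arguments lipdom {R} X _ : rename.
Arguments lip {R} X _ : rename.

Section quantum_compact_metric_space.
Variable R : realType.

Definition mk (X : lipPair R) (phi psi : state X) : \bar R :=
  ereal_sup [set (normc (phi a - psi a))%:E
            | a in [set a | lipdom X a /\ lip X a <= 1]].

Definition metrizes (T : topologicalType) (d : T -> T -> \bar R) : Prop :=
  [/\ forall x y, d x y \is a fin_num,
      forall x y, d x y = 0%E <-> x = y,
      forall x y, d x y = d y x,
      forall x y z, (d x z <= d x y + d y z)%E &
      forall x (U : set T), nbhs x U <->
        exists2 e : R, 0 < e & [set y | (d x y < e%:E)%E] `<=` U].

Record jordan_lie_subalgebra (A : cstarAlgType R) (D : set A) : Prop := {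
  jls_sa : D `<=` @selfadjoint R A;
  jls_0 : D 0;
  jls_D : forall a b, D a -> D b -> D (a + b);
  jls_Z : forall (t : R) a, D a -> D (t%:C *: a);
  jls_jordan : forall a b, D a -> D b -> D (jordan a b);
  jls_lie : forall a b, D a -> D b -> D (lie a b)
}.

Record is_qcms (X : lipPair R) : Prop := {
  qcms_dom : jordan_lie_subalgebra (lipdom X);
  qcms_dense :
    @selfadjoint R X `<=` closure (lipdom X : set (realnormed X));
  lip_ge0 : forall a, lipdom X a -> 0 <= lip X a;
  lipD : forall a b, lipdom X a -> lipdom X b ->
    lip X (a + b) <= lip X a + lip X b;
  lipZ : forall (t : R) a, lipdom X a -> lip X (t%:C *: a) = `|t| * lip X a;
  lip_eq0 : [set a | lipdom X a /\ lip X a = 0]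
    = [set t%:C *: (1 : X) | t in [set: R]];
  lip_metrizes : metrizes (@mk X);
  lip_leibniz : forall a b, lipdom X a -> lipdom X b ->
    Num.max (lip X (jordan a b)) (lip X (lie a b))
      <= lip X a * cnorm b + cnorm a * lip X b;
  lip_closed :
    closed ([set a | lipdom X a /\ lip X a <= 1] : set (realnormed X))
}.

Definition strongly_leibniz (X : lipPair R) : Prop :=
  forall a b : X, a * b = 1 -> b * a = 1 -> lipdom X a ->
    lipdom X b /\ lip X b <= cnorm b ^+ 2 * lip X a.

Record quantum_isometry (X Y : lipPair R) (p : {lrmorphism X -> Y}) : Prop := {
  qi_star : star_preserving p;
  qi_surj : forall b, exists a, p a = b;
  qi_dom : forall a, lipdom X a -> lipdom Y (p a);
  qi_lip : forall b, lipdom Y b ->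
    (lip Y b)%:E
      = ereal_inf [set (lip X a)%:E | a in [set a | lipdom X a /\ p a = b]]
}.

Record tunnel (X1 X2 : lipPair R) := Tunnel {
  tunnel_space : lipPair R;
  tunnel_qcms : is_qcms tunnel_space;
  tunnel_proj1 : {lrmorphism tunnel_space -> X1};
  tunnel_proj2 : {lrmorphism tunnel_space -> X2};
  tunnel_qi1 : quantum_isometry tunnel_proj1;
  tunnel_qi2 : quantum_isometry tunnel_proj2
}.

Definition hausdorff_dist (T : Type) (d : T -> T -> \bar R) (P Q : set T)
    : \bar R :=
  maxe (ereal_sup [set ereal_inf [set d x y | y in Q] | x in P])
       (ereal_sup [set ereal_inf [set d x y | x in P] | y in Q]).

Definition extent (X1 X2 : lipPair R) (t : tunnel X1 X2) : \bar R :=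
  maxe (hausdorff_dist (@mk (tunnel_space t)) setT
          (range (pullback (qi_star (tunnel_qi1 t)))))
       (hausdorff_dist (@mk (tunnel_space t)) setT
          (range (pullback (qi_star (tunnel_qi2 t))))).

Definition propinquity_SL (X1 X2 : lipPair R) : \bar R :=
  ereal_inf [set e | exists2 t : tunnel X1 X2,
                       strongly_leibniz (tunnel_space t) & e = extent t].

End quantum_compact_metric_space.

Section conditional_expectation.
Variables (R : realType) (A : cstarAlgType R).

Definition faithful_tracial (rho : state A) : Prop :=
  (forall a, rho (star a * a) = 0 -> a = 0) /\
  (forall a b, rho (a * b) = rho (b * a)).

Record conditional_expectation (V : set A) (E : {linear A -> A}) : Prop := {
  condexp_im : forall a, V (E a);
  condexp_id : forall b, V b -> E b = b;
  condexp_ge0 : forall a, exists c, E (star a * a) = star c * c;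
  condexp_bimod : forall b a c, V b -> V c -> E (b * a * c) = b * E a * c
}.

Definition faithful (E : {linear A -> A}) : Prop :=
  forall a, E (star a * a) = 0 -> a = 0.

Definition preserves (rho : state A) (E : {linear A -> A}) : Prop :=
  forall a, rho (E a) = rho a.

Definition condexp_norm (E : {linear A -> A}) (a : A) : R :=
  Num.sqrt (cnorm (E (star a * a))).

End conditional_expectation.

Definition baire : Type := nat -> {k : nat | (0 < k)%N}.

Definition baire_dist (R : realType) (x y : baire) : R :=
  if pselect (exists n, x n != y n) is left xy then 2^-1 ^+ ex_minn xy else 0.

Definition boxtimes (beta : baire) (n : nat) : nat :=
  \prod_(j < n) (val (beta j)).+1.

Lemma boxtimes_gt0 (beta : baire) (n : nat) : (0 < boxtimes beta n)%N.
Proof. by rewrite prodn_gt0. Qed.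

Section uhf.
Variables (R : realType) (beta : baire).

(* By [boxtimes_gt0] the size is [boxtimes beta n]; its successor form is what
   the canonical ring structure on square matrices requires. *)
Definition uhf_mx (n : nat) : cstarAlgType R :=
  'M[R[i]]_((boxtimes beta n).-1.+1).

Definition diag_copies (n : nat) (a : uhf_mx n) : uhf_mx n.+1 :=
  \matrix_(p, q)
    if (p %/ boxtimes beta n == q %/ boxtimes beta n)%N
    then fun_of_matrix a (inord (p %% boxtimes beta n)%N)
                         (inord (q %% boxtimes beta n)%N)
    else 0.

Definition gamma (n : nat) : R :=
  (\dim (fullv : {vspace 'M[R[i]]_(boxtimes beta n)}))%:R^-1.

(* The colimit in the category of unital C*-algebras. *)
Record inductive_limit (A : cstarAlgType R)
    (mu : forall n, {lrmorphism uhf_mx n -> A}) : Prop := {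
  limit_star : forall n, star_preserving (mu n);
  limit_inj : forall n, injective (mu n);
  limit_compat : forall n a, mu n.+1 (diag_copies a) = mu n a;
  limit_universal : forall (B : cstarAlgType R)
    (f : forall n, {lrmorphism uhf_mx n -> B}),
    (forall n, star_preserving (f n)) ->
    (forall n a, f n.+1 (diag_copies a) = f n a) ->
    exists g : {lrmorphism A -> B},
      [/\ star_preserving g,
          forall n a, g (mu n a) = f n a &
          forall h : {lrmorphism A -> B}, star_preserving h ->
            (forall n a, h (mu n a) = f n a) -> h =1 g]
}.

Variables (A : cstarAlgType R) (lambda : nat -> R) (E : nat -> {linear A -> A}).

Definition uhf_lip (n : nat) (a : A) : R :=
  \big[Num.max/0]_(m < n)
    (Num.max (condexp_norm (E m) (a - E m a))
             (condexp_norm (E m) (star a - E m (star a)))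
     / (lambda m * gamma m)).

(* The image of [mu n] with the seminorm [uhf_lip n], read on [uhf_mx n]
   through the isomorphism [mu n] onto this image. *)
Definition uhf_level (mu : forall n, {lrmorphism uhf_mx n -> A}) (n : nat)
    : lipPair R :=
  @LipPair R (uhf_mx n) (@selfadjoint R (uhf_mx n))
    (fun x => uhf_lip n (mu n x)).

End uhf.

(* Main.v *)
(* If [beta] and [eta] agree below [N], the two inductive systems coincide up to
   level [N]. The trace of a matrix algebra is unique, so it determines the
   conditional expectations on level [N], and an injective *-morphism from a
   matrix algebra is isometric; hence both level-[N] spaces are equal, say to [B].
   Both limits are within [8 / 2^N] of [B], as [gamma j <= 2^-j], and the triangle
   inequality through [B] concludes. For the latter, tunnels [D1] from [B] to [X1]
   and [D2] from [B] to [X2] are glued along [B]: the algebra is [D1 (+) D2] and the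
   seminorm is [max (L1 d1) (L2 d2) (|pi1 d1 - pi2 d2| / eps)]. *)
From HB Require Import structures.
Require Import Defs.
From mathcomp Require Import all_boot all_order all_algebra.
From mathcomp Require Import complex ring lra.
From mathcomp Require Import all_classical all_reals all_analysis.
Set Implicit Arguments. Unset Strict Implicit. Unset Printing Implicit Defensive.
Import Order.TTheory GRing.Theory Num.Theory.
Import numFieldNormedType.Exports.
Import ComplexField.Normc.
Local Open Scope classical_set_scope.
Local Open Scope ring_scope.

(** * C*-algebra basics and positive functionals *)

(** The term [|pi1 d1 - pi2 d2| / eps] obeys the Leibniz inequalities because [pi1] and [pi2] are
    contractive. As [B] is a matrix algebra, contractivity follows from vector functionals and
    Cauchy-Schwarz rather than from spectral theory; the only positivity fact behind it is that
    [1 - h] has the form [star b * b] for self-adjoint [h] of norm below 1. The delicate point of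
    the gluing is metrization. A state of [D1 (+) D2] is a convex combination [s phi1 + t phi2], and
    weak* closeness controls [t phi2] but says nothing about [phi2] when [t] is near 0; the finite
    diameter of each summand covers that case. The level spaces are proved equal as records, not
    merely isometric, so that the two tunnels literally start at the same space. In [8 / 2^N], the
    factor 4 is that of the approximation hypothesis and [2 / 2^N] is the tail of the geometric
    series. *)

Section cstar_basics.
Variables (R : realType) (A : cstarAlgType R).
Implicit Types a b : A.

Lemma cnorm_ge0 a : 0 <= cnorm a.
Proof. exact: (normr_ge0 (a : realnormed A)). Qed.

Lemma cnorm0 : cnorm (0 : A) = 0.
Proof. exact: (normr0 (realnormed A)). Qed.

Lemma cnormN a : cnorm (- a) = cnorm a.
Proof. exact: (normrN (a : realnormed A)). Qed.

Lemma cnorm_distC a b : cnorm (a - b) = cnorm (b - a).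
Proof. by rewrite -cnormN opprB. Qed.

Lemma cnorm_triangle b a c : cnorm (a - c) <= cnorm (a - b) + cnorm (b - c).
Proof. by rewrite (le_trans _ (cnormD _ _))// addrA subrK. Qed.

Lemma cnormZr (t : R) a : cnorm (t%:C%C *: a) = `|t| * cnorm a.
Proof. exact: rnormZ. Qed.

Lemma star0 : star (0 : A) = 0.
Proof. by apply: (addIr (star 0)); rewrite -starD !add0r. Qed.

Lemma starN a : star (- a) = - star a.
Proof. by apply: (addIr (star a)); rewrite -starD !addNr star0. Qed.

Lemma starB a b : star (a - b) = star a - star b.
Proof. by rewrite starD starN. Qed.

Lemma star1 : star (1 : A) = 1.
Proof. by rewrite -[LHS]mulr1 -[1 in X in _ * X](@starK R A) -starM mulr1 starK. Qed.

Lemma starZr (t : R) a : star (t%:C%C *: a) = t%:C%C *: star a.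
Proof. by rewrite starZ; congr (_ *: _); exact: conjc_real. Qed.

Lemma cnorm_star a : cnorm (star a) = cnorm a.
Proof.
have le b : cnorm b <= cnorm (star b).
  have [->|b0] := eqVneq (cnorm b) 0; first exact: cnorm_ge0.
  have pb : 0 < cnorm b by rewrite lt_def b0 cnorm_ge0.
  by rewrite -(ler_pM2r pb) -expr2 -cnorm_starM cnormM.
by apply/eqP; rewrite eq_le le andbT -[X in _ <= cnorm X]starK le.
Qed.

Lemma cnorm1 : cnorm (1 : A) = 1.
Proof.
have n1 : cnorm (1 : A) != 0.
  by apply/eqP => /cnorm0_eq0 /eqP; rewrite oner_eq0.
by apply: (mulfI n1); rewrite -expr2 -cnorm_starM star1 !mulr1.
Qed.

Lemma sa_complex a :
  exists b c, [/\ star b = b, star c = c & a = b + 'i%C *: c].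
Proof.
have i2 : 'i%C * 'i%C = -1 :> R[i] by rewrite -expr2 sqr_i.
have ic : Num.conj ('i%C : R[i]) = - 'i%C.
  by apply/eqP; rewrite eq_complex /= oppr0 !eqxx.
pose h : R := 2^-1.
exists (h%:C%C *: (a + star a)), (h%:C%C *: ('i%C *: (star a - a))); split.
- by rewrite starZr starD starK addrC.
- by rewrite starZr starZ starB starK ic scaleNr -scalerN opprB.
have -> : 'i%C *: (h%:C%C *: ('i%C *: (star a - a))) = h%:C%C *: (a - star a).
  by rewrite !scalerA mulrAC i2 mulN1r scaleNr -scalerN opprB.
rewrite -scalerDr addrACA subrr addr0 -[X in _ *: (X + _)]scale1r.
rewrite -[X in _ *: (_ + X)]scale1r -scalerDl scalerA.
rewrite -[1 + 1 : R[i]](rmorphD (real_complex R) 1 1).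
by rewrite -(rmorphM (real_complex R)) mulrDr mulr1 /h -[2^-1]mul1r -splitr scale1r.
Qed.

Lemma realnormed_closureP (S : set (realnormed A)) (a : A) :
  closure S a <-> forall e : R, 0 < e -> exists2 b : A, S b & cnorm (a - b) < e.
Proof.
split=> [Sa e e0|Sa B].
  have [b [Sb ab]] := Sa _ (nbhsx_ballx (a : realnormed A) e e0).
  by exists b => //; move: ab; rewrite -ball_normE.
move=> /nbhs_ballP[e e0 aB]; have [b Sb ab] := Sa _ e0.
by exists b; split => //; apply: aB; rewrite -ball_normE.
Qed.

Lemma realnormed_closedP (S : set (realnormed A)) :
  closed S <-> forall a : A,
    (forall e : R, 0 < e -> exists2 b : A, S b & cnorm (a - b) < e) -> S a.
Proof.
by split=> H a; [move=> /realnormed_closureP/H|move=> /realnormed_closureP/H].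
Qed.

End cstar_basics.

Section positivity.
Variables (R : realType) (A : cstarAlgType R).
Implicit Types a b : A.

(* [1 - h = (1 - y)^2] for the fixed point [y] of the contraction
   [y |-> (h + y^2) / 2] of the ball of radius [cnorm h]. *)
Lemma sa_sqrt (h : A) : star h = h -> cnorm h < 1 ->
  exists b : A, 1 - h = star b * b.
Proof.
move=> hs h1.
have h0 : 0 <= cnorm h by exact: cnorm_ge0.
pose U : set (realnormed A) := [set y | star (y : A) = y /\ cnorm (y : A) <= cnorm h].
pose f (y : realnormed A) : realnormed A :=
  (2^-1 : R)%:C%C *: (h + (y : A) * (y : A)) : A.
have fU : set_fun U U f.
  move=> y [ys yh]; split; rewrite /f.
    by rewrite starZr starD starM hs ys.
  rewrite cnormZr gtr0_norm// mulrC ler_pdivrMr// mulr_natr mulr2n.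
  rewrite (le_trans (cnormD _ _))// lerD2l (le_trans (cnormM _ _))//.
  by rewrite -[leRHS]mul1r ler_pM ?cnorm_ge0// (le_trans yh)// ltW.
pose g : {fun U >-> U} := HB.pack f (isFun.Build _ _ U U f fU).
have cg : is_contraction g.
  exists (NngNum h0); split => //= -[y z] [[_ yh] [_ zh]] /=.
  change (cnorm (f y - f z : A) <= cnorm h * cnorm ((y : A) - (z : A))).
  rewrite /f -scalerBr cnormZr gtr0_norm// mulrC ler_pdivrMr//.
  rewrite opprD addrACA subrr add0r.
  have -> : (y : A) * (y : A) - (z : A) * (z : A) =
     (y : A) * ((y : A) - (z : A)) + ((y : A) - (z : A)) * (z : A).
    by rewrite mulrBr mulrBl addrA subrK.
  rewrite (le_trans (cnormD _ _))// mulr_natr mulr2n.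
  rewrite lerD// (le_trans (cnormM _ _))//.
    by rewrite ler_wpM2r ?cnorm_ge0.
  by rewrite mulrC ler_wpM2r ?cnorm_ge0.
have cU : closed U.
  apply/realnormed_closedP => a aU; split.
    apply/eqP; rewrite -subr_eq0; apply/eqP/cnorm0_eq0/eqP.
    rewrite eq_le cnorm_ge0 andbT; apply/ler_addgt0Pr => e e0; rewrite add0r.
    have [b [bs _] ab] := aU (e / 2) (divr_gt0 e0 (ltr0Sn R 1)).
    rewrite (le_trans (cnorm_triangle b _ _))// [leRHS]splitr.
    by rewrite -[b in X in X + _ <= _]bs -starB cnorm_star [X in _ + X]cnorm_distC
      lerD// ltW.
  apply/ler_addgt0Pr => e e0; have [b [_ bh] ab] := aU e e0.
  rewrite -[a](subrK b) (le_trans (cnormD _ _))// addrC lerD// ltW//.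
have [|y [ys _] yf] := banach_fixed_point cg cU.
  by exists 0; split; rewrite ?star0 ?cnorm0.
exists (1 - (y : A)); rewrite starB star1 ys mulrBr mulrBl mulrBl !mulr1 !mul1r.
have {}yf : (y : A) + (y : A) = h + (y : A) * (y : A).
  rewrite {1 2}yf /= /f -scalerDl -(rmorphD (real_complex R)).
  by rewrite -[2^-1]mul1r -splitr scale1r.
by rewrite opprB [_ * _ - _]addrC addrA -[_ - _ - _]addrA -opprD yf opprD addrA subrK.
Qed.

End positivity.

Lemma normcr (R : realType) (t : R) : normc (t%:C)%C = `|t|.
Proof. by rewrite /= expr0n addr0 sqrtr_sqr. Qed.

Lemma gec0_real (R : realType) (z : R[i]) : 0 <= z ->
  exists2 t : R, 0 <= t & z = t%:C%C.
Proof.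
by case: z => x y /=; rewrite lecE /= => /andP[/eqP-> x0]; exists x.
Qed.

(** * Cauchy-Schwarz and the norm of a positive functional *)

Section positive_functionals.
Variables (R : realType) (A : cstarAlgType R) (phi : {scalar A}).
Hypothesis phi_ge0 : forall a, 0 <= phi (star a * a).
Implicit Types a b : A.

Lemma functional_square a b (z : R[i]) :
  phi (star (a + z *: b) * (a + z *: b)) =
    phi (star a * a) + z * phi (star a * b) +
    (conjc z * phi (star b * a) + conjc z * z * phi (star b * b)).
Proof.
have -> : star (a + z *: b) * (a + z *: b) =
    star a * a + z *: (star a * b) +
    (conjc z *: (star b * a) + (conjc z * z) *: (star b * b)).
  by rewrite starD starZ mulrDl !mulrDr -!scalerAr -!scalerAl scalerA [z * _]mulrC.
by rewrite !linearD !linearZ.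
Qed.

(** Polarisation: [phi] is real at the squares of [a + b] and [a + i b], which gives one real
    equation for each of the real and imaginary parts. *)
Lemma functional_star a b : phi (star b * a) = conjc (phi (star a * b)).
Proof.
have Im0 c : complex.Im (phi (star c * c)) = 0.
  by have [t _ ->] := gec0_real (phi_ge0 c).
have := Im0 (a + 1 *: b); have := Im0 (a + 'i%C *: b); rewrite !functional_square.
move: (Im0 a) (Im0 b).
case: (phi (star a * a)) => p1 p2; case: (phi (star b * b)) => q1 q2.
case: (phi (star a * b)) => x1 x2; case: (phi (star b * a)) => y1 y2 /= -> ->.
by move=> h1 h2; congr Complex; lra.
Qed.

Lemma functional_cauchy a b p q : 0 <= q ->
  phi (star a * a) = p%:C%C -> phi (star b * b) = q%:C%C ->
  normc (phi (star b * a)) ^+ 2 <= p * q.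
Proof.
move=> q0 ap bq; set z := phi (star b * a).
(* Positivity at [a - s z b]; the phase of [z] makes the cross terms real. *)
have key (s : R) : 0 <= p - 2 * s * normc z ^+ 2 + s ^+ 2 * normc z ^+ 2 * q.
  have := phi_ge0 (a + (- s%:C%C * z) *: b).
  rewrite functional_square ap bq (functional_star b a) -/z.
  have -> : normc z ^+ 2 = complex.Re z ^+ 2 + complex.Im z ^+ 2.
    by case: (z) => u v /=; rewrite sqr_sqrtr// addr_ge0// sqr_ge0.
  case: z => u v /=; rewrite lecE /= => /andP[_].
  by congr (0 <= _); ring.
have [qe|qn] := eqVneq q 0.
  rewrite qe mulr0; rewrite leNgt; apply/negP => z0.
  (* With [q = 0] this [s] gives the left side of [key] the value -1. *)
  have := key ((p + 1) / (2 * normc z ^+ 2)).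
  rewrite qe mulr0 addr0.
  have -> : 2 * ((p + 1) / (2 * normc z ^+ 2)) * normc z ^+ 2 = p + 1.
    by field; apply: contraTneq z0 => ->; rewrite expr0n ltxx.
  lra.
have qp : 0 < q by rewrite lt_def qn.
(* The minimiser of the quadratic in [s]. *)
have := key q^-1.
have -> : p - 2 * q^-1 * normc z ^+ 2 + q^-1 ^+ 2 * normc z ^+ 2 * q
  = (p * q - normc z ^+ 2) / q by field.
by rewrite pmulr_lge0 ?invr_gt0// subr_ge0.
Qed.

(** For [s > cnorm a], [sa_sqrt] writes [1 - star a * a / s^2] as [star b * b], hence
    [phi (star a * a) <= r s^2]; Cauchy-Schwarz against 1 gives [r s], and [s] then decreases to
    [cnorm a]. The strict inequality is what [sa_sqrt] asks for. *)
Lemma functional_le a r : phi 1 = r%:C%C -> normc (phi a) <= r * cnorm a.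
Proof.
move=> phi1.
have r0 : 0 <= r.
  have := phi_ge0 1; rewrite star1 mulr1 phi1.
  by move=> /gec0_real[t t0 [->]].
have sq (s : R) : cnorm a < s -> normc (phi a) <= r * s.
  move=> as_; have s0 : 0 < s by rewrite (le_lt_trans (cnorm_ge0 a)).
  have [p p0 ap] := gec0_real (phi_ge0 a).
  have ps : p <= r * s ^+ 2.
    have s2 : 0 < s ^- 2 by rewrite invr_gt0 exprn_gt0.
    have [||b hb] := @sa_sqrt R A ((s ^- 2)%:C%C *: (star a * a)).
    - by rewrite starZr starM starK.
    - rewrite cnormZr cnorm_starM gtr0_norm// mulrC ltr_pdivrMr ?exprn_gt0// mul1r.
      by rewrite ltr_pXn2r// nnegrE ?cnorm_ge0 ?ltW.
    have := phi_ge0 b; rewrite -hb linearB linearZ /= phi1 ap.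
    rewrite -(rmorphM (real_complex R)) -(rmorphB (real_complex R)).
    move=> /gec0_real[t t0 [tE]]; move: t0; rewrite -tE subr_ge0 mulrC.
    by rewrite ler_pdivrMr// exprn_gt0.
  have /(functional_cauchy r0 ap) : phi (star 1 * 1) = r%:C%C by rewrite star1 mulr1.
  rewrite star1 mul1r => h.
  rewrite -(@ler_pXn2r _ 2) ?nnegrE ?mulr_ge0 ?normc_ge0 ?(ltW s0)//.
  rewrite (le_trans h)// exprMn mulrC expr2 -mulrA ler_wpM2l//.
have [r00|rn] := eqVneq r 0.
  by have := sq (cnorm a + 1); rewrite r00 !mul0r; apply; rewrite ltrDl.
have rp : 0 < r by rewrite lt_def rn.
apply/ler_addgt0Pr => e e0.
have := sq (cnorm a + e / r); rewrite mulrDr mulrCA divff ?mulr1//; apply.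
by rewrite ltrDl divr_gt0.
Qed.

End positive_functionals.

Lemma state_le (R : realType) (A : cstarAlgType R) (phi : state A) (a : A) :
  normc (phi a) <= cnorm a.
Proof.
have := @functional_le R A phi (@state_ge0 R A phi) a 1; rewrite mul1r; apply.
exact: state1.
Qed.

(** * Direct sums of two C*-algebras *)

Section product.
Variables (R : realType) (A B : cstarAlgType R).
Implicit Types x y : (A * B)%type.

Definition pair_star x : (A * B)%type := (star x.1, star x.2).
Definition pair_cnorm x : R := Num.max (cnorm x.1) (cnorm x.2).

Lemma pair_starD : {morph pair_star : x y / x + y}.
Proof. by move=> x y; rewrite /pair_star !starD. Qed.

Lemma pair_starZ (c : R[i]) x : pair_star (c *: x) = Num.conj c *: pair_star x.
Proof. by rewrite /pair_star !starZ. Qed.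

Lemma pair_starM x y : pair_star (x * y) = pair_star y * pair_star x.
Proof. by rewrite /pair_star !starM. Qed.

Lemma pair_starK : involutive pair_star.
Proof. by case=> a b; rewrite /pair_star !starK. Qed.

Lemma pair_cnorm_le1 x : cnorm x.1 <= pair_cnorm x.
Proof. by rewrite le_max lexx. Qed.

Lemma pair_cnorm_le2 x : cnorm x.2 <= pair_cnorm x.
Proof. by rewrite le_max lexx orbT. Qed.

Lemma pair_cnormD x y : pair_cnorm (x + y) <= pair_cnorm x + pair_cnorm y.
Proof.
rewrite ge_max !(le_trans (cnormD _ _))// lerD//;
  by [exact: pair_cnorm_le1|exact: pair_cnorm_le2].
Qed.

Lemma pair_cnormZ (c : R[i]) x : pair_cnorm (c *: x) = normc c * pair_cnorm x.
Proof. by rewrite /pair_cnorm !cnormZ maxr_pMr// normc_ge0. Qed.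

Lemma pair_cnorm0_eq0 x : pair_cnorm x = 0 -> x = 0.
Proof.
move=> x0; have h a : 0 <= a -> a <= pair_cnorm x -> a = 0.
  by move=> a0; rewrite x0 => ax; apply/eqP; rewrite eq_le ax a0.
have := h _ (cnorm_ge0 x.1) (pair_cnorm_le1 x).
have := h _ (cnorm_ge0 x.2) (pair_cnorm_le2 x).
by case: x {x0 h} => a b /= /cnorm0_eq0 -> /cnorm0_eq0 ->.
Qed.

Lemma pair_cnormM x y : pair_cnorm (x * y) <= pair_cnorm x * pair_cnorm y.
Proof.
rewrite ge_max !(le_trans (cnormM _ _))// ler_pM ?cnorm_ge0//;
  by [exact: pair_cnorm_le1|exact: pair_cnorm_le2].
Qed.

Lemma pair_cnorm_starM x : pair_cnorm (pair_star x * x) = pair_cnorm x ^+ 2.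
Proof.
rewrite /pair_cnorm !cnorm_starM /=.
have [h|h] := leP (cnorm x.1) (cnorm x.2); apply/eqP.
  by rewrite eq_maxr// ler_pXn2r// nnegrE cnorm_ge0.
by rewrite eq_maxl// ltW// ltr_pXn2r// nnegrE cnorm_ge0.
Qed.

HB.instance Definition _ := Algebra_isCstarNormed.Build R (A * B)%type
  pair_starD pair_starZ pair_starM pair_starK
  pair_cnormD pair_cnormZ pair_cnorm0_eq0 pair_cnormM pair_cnorm_starM.

Lemma pair_complete (F : set_system (realnormed (A * B)%type)) :
  ProperFilter F -> cauchy F -> cvg F.
Proof.
move=> FF /cauchy_ballP Fc.
have cv (C : cstarAlgType R) (p : realnormed (A * B)%type -> realnormed C) :
    (forall x y : realnormed (A * B)%type, `|p x - p y| <= `|x - y|) -> cvg (p @ F).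
  move=> pp; have FpF : ProperFilter (p @ F) by exact: fmap_proper_filter.
  apply: cauchy_cvg; apply/cauchy_ballP => e e0.
  have [[P Q] /= [FP FQ] PQ] := Fc _ e0.
  exists (p @` P, p @` Q) => /=.
    by split; [apply: filterS FP|apply: filterS FQ] => a ?; exists a.
  move=> [_ _] /= [[a Pa <-] [b Qb <-]].
  have := PQ (a, b) (conj Pa Qb); rewrite -!ball_normE /= => ab.
  exact: le_lt_trans (pp _ _) ab.
have c1 := cv A (fun x => (x : A * B).1)
  (fun x y => pair_cnorm_le1 ((x : A * B) - (y : A * B))).
have c2 := cv B (fun x => (x : A * B).2)
  (fun x y => pair_cnorm_le2 ((x : A * B) - (y : A * B))).
move: c1 c2 => /cvg_ex[l1 l1P] /cvg_ex[l2 l2P].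
apply/cvg_ex; exists ((l1 : A, l2 : B) : realnormed (A * B)%type).
apply/cvgrPdist_lt => e e0.
move/cvgrPdist_lt/(_ e e0) : l1P => l1P; move/cvgrPdist_lt/(_ e e0) : l2P => l2P.
near=> x.
change (pair_cnorm ((l1 : A, l2 : B) - (x : A * B)) < e).
rewrite gt_max; apply/andP; split.
  by near: x; exact: l1P.
by near: x; exact: l2P.
Unshelve. all: by end_near. Qed.

HB.instance Definition _ := PreCstar_isComplete.Build R (A * B)%type pair_complete.

End product.

(** * The weak* topology and the Monge-Kantorovich metric *)

Section weak_star.
Variables (R : realType) (A : cstarAlgType R).
Implicit Types (phi psi : state A) (s : seq A).

Definition weak_ball phi s (d : R) : set (state A) :=
  [set psi | forall a, a \in s -> normc (psi a - phi a) < d].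

Lemma weak_ball_cons phi a s d :
  weak_ball phi (a :: s) d =
    [set psi : state A | normc (psi a - phi a) < d] `&` weak_ball phi s d.
Proof.
apply/seteqP; split=> psi.
  by move=> h; split => [|b bs]; apply: h; rewrite inE ?eqxx ?bs ?orbT.
by move=> [h1 h2] b; rewrite inE => /orP[/eqP->|/h2].
Qed.

Lemma nbhs_weak_ball phi s d : 0 < d -> nbhs (phi : state A) (weak_ball phi s d).
Proof.
move=> d0; elim: s => [|a s IH]; first by apply: filterS filterT.
rewrite weak_ball_cons; apply: filterI => //.
have : {for (phi : state A), continuous (fun psi : state A => (psi a : R[i]^o))}.
  apply: (@continuous_comp (state A) {ptws A -> R[i]^o} _
    (@state_eval R A) (fun f => f a)).
    exact: (@initial_continuous (state A) _ (@state_eval R A)).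
  exact: (@proj_continuous A (fun=> R[i]^o : topologicalType) a).
move=> /cvgrPdist_lt /(_ d%:C%C); rewrite ltcR => /(_ d0).
by apply: filterS => psi /=; rewrite distrC => h; rewrite -ltcR Defs.normcE.
Qed.

(** The weak balls at [phi] generate a filter that converges pointwise to [phi] along [state_eval],
    so it refines the neighbourhood filter of the initial topology. *)
Lemma weak_nbhsP phi (U : set (state A)) :
  nbhs (phi : state A) U <-> exists s d, 0 < d /\ weak_ball phi s d `<=` U.
Proof.
split; last first.
  by move=> [s [d [d0 sU]]]; apply: filterS sU _; exact: nbhs_weak_ball.
case=> _ [[V oV <-] Vphi] VU.
pose F := filter_from [set sd : seq A * R | 0 < sd.2]
  (fun sd => weak_ball phi sd.1 sd.2).
have FF : Filter F.
  apply: filter_from_filter; first by exists ([::], 1) => /=.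
  move=> [s d] [s' d'] /= d0 d'0; exists (s ++ s', Num.min d d') => /=.
    by rewrite lt_min d0.
  move=> psi h; split => a as_; have := h a; rewrite mem_cat as_ ?orbT /=.
    by move=> /(_ isT); rewrite lt_min => /andP[].
  by move=> /(_ isT); rewrite lt_min => /andP[].
suff : (@state_eval R A) @ F --> (state_eval phi).
  move=> /(_ V) []; first exact: open_nbhs_nbhs.
  by move=> [s d] /= d0 sdV; exists s, d; split => // psi /sdV/VU.
apply/cvg_sup => a; apply/cvg_image.
  by apply/seteqP; split => // z _; exists (fun=> z).
move=> N /nbhs_ballP[e /= e0 eN].
exists [set f : {ptws A -> R[i]^o} | N (f a)]; last first.
  apply/seteqP; split => [_ [f Nf <-]//|z Nz]; exists (fun=> z) => //.
have [d d0 dE] := gec0_real (ltW e0).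
exists ([:: a], d) => /=; first by rewrite -ltcR -dE.
move=> psi /(_ a); rewrite mem_head => /(_ isT) h; apply: eN.
by rewrite -ball_normE /= distrC dE -Defs.normcE ltcR.
Qed.

Lemma state_ext phi psi : (forall a, phi a = psi a) -> phi = psi.
Proof.
case: phi psi => [[f [[m1] [m2]]] f0 f1] [[g [[n1] [n2]]] g0 g1] /= /funext fg.
move: m1 m2 f0 f1; rewrite {}fg => m1 m2 f0 f1.
by rewrite (Prop_irrelevance m1 n1) (Prop_irrelevance m2 n2) in f0 f1 *;
  rewrite (Prop_irrelevance f0 g0) (Prop_irrelevance f1 g1).
Qed.

Lemma stateZ phi (c : R[i]) a : phi (c *: a) = c * phi a.
Proof. exact: linearZ. Qed.

Lemma stateD phi a b : phi (a + b) = phi a + phi b.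
Proof. exact: raddfD. Qed.

Lemma state_bounded phi psi a : normc (phi a - psi a) <= 2 * cnorm a.
Proof.
rewrite (le_trans (ler_normcD _ _))// normcN mulr_natl mulr2n.
by rewrite lerD ?state_le.
Qed.

Section mixture.
Variables (phi psi : state A) (s t : R).
Hypotheses (s0 : 0 <= s) (t0 : 0 <= t) (st : s + t = 1).

Definition mix_fun (a : A) : R[i] := s%:C%C * phi a + t%:C%C * psi a.

Lemma mix_is_linear : scalar mix_fun.
Proof. by move=> c a b; rewrite /mix_fun !linearP /=; ring. Qed.
HB.instance Definition _ :=
  GRing.isLinear.Build R[i] A R[i] *%R mix_fun mix_is_linear.

Lemma mix_ge0 a : 0 <= mix_fun (star a * a).
Proof. by rewrite addr_ge0// mulr_ge0 ?state_ge0// lecR. Qed.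

Lemma mix1 : mix_fun 1 = 1.
Proof. by rewrite /mix_fun !state1 !mulr1 -(rmorphD (real_complex R)) st. Qed.

Definition mix : state A := State mix_ge0 mix1.

End mixture.

End weak_star.

(** * When the Monge-Kantorovich distance metrizes the weak* topology, and what follows if it
    does *)

Section monge_kantorovich.
Variables (R : realType) (X : lipPair R).
Implicit Types (phi psi : state X) (a : X).

Definition lipball : set X := [set a | lipdom X a /\ lip X a <= 1].

Lemma mk_ge phi psi a : lipball a -> ((normc (phi a - psi a))%:E <= mk phi psi)%E.
Proof. by move=> aX; apply: ereal_sup_ubound; exists a. Qed.

Lemma mk_leP phi psi (r : R) :
  (mk phi psi <= r%:E)%E <-> forall a, lipball a -> normc (phi a - psi a) <= r.
Proof.
split=> [h a aX|h]; first by rewrite -lee_fin (le_trans (mk_ge phi psi aX)).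
by apply: ge_ereal_sup => _ [a aX <-]; rewrite lee_fin h.
Qed.

Lemma mkC phi psi : mk phi psi = mk psi phi.
Proof.
rewrite /mk; congr ereal_sup; apply: eq_imagel => a _.
by rewrite -normcN opprB.
Qed.

Section criterion.
Hypotheses (X_jls : jordan_lie_subalgebra (lipdom X))
  (X_dense : @selfadjoint R X `<=` closure (lipdom X : set (realnormed X)))
  (X_ge0 : forall a, lipdom X a -> 0 <= lip X a)
  (X_Z : forall (t : R) a, lipdom X a -> lip X (t%:C%C *: a) = `|t| * lip X a).

Lemma lipball0 : lipball 0.
Proof.
split; first exact: jls_0.
have := X_Z 0 (jls_0 X_jls); rewrite scaler0 normr0 mul0r => ->.
exact: ler01.
Qed.

Lemma lipball_scale a t : lipdom X a -> lip X a <= t -> 0 < t ->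
  lipball ((t^-1)%:C%C *: a).
Proof.
move=> aX at_ t0; split; first exact: jls_Z.
by rewrite X_Z// gtr0_norm ?invr_gt0// mulrC ler_pdivrMr// mul1r.
Qed.

Lemma state_dist_scale phi psi r a t : (mk phi psi <= r%:E)%E ->
  lipdom X a -> lip X a <= t -> 0 < t -> normc (phi a - psi a) <= t * r.
Proof.
move=> /mk_leP h aX at_ t0; have := h _ (lipball_scale aX at_ t0).
rewrite !stateZ -mulrBr normcM normcr gtr0_norm ?invr_gt0//.
by rewrite ler_pdivrMl.
Qed.

(** Split [a] into self-adjoint parts and approximate each by a Lipschitz element. As [K] depends on
    [a] and [d] only, closeness for [mk] forces weak* closeness. *)
Lemma state_dist_approx a d : 0 < d -> exists2 K, 0 <= K &
  forall phi psi r, (mk phi psi <= r%:E)%E -> normc (phi a - psi a) <= d + K * r.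
Proof.
move=> d0; have [b [c [bs cs ->]]] := sa_complex a.
have sa_case x : star x = x -> exists2 K, 0 <= K &
    forall phi psi r, (mk phi psi <= r%:E)%E -> normc (phi x - psi x) <= d / 2 + K * r.
  move=> xs.
  (* One half for the factor 2 of [state_bounded]; [d / 2] is the share of each self-adjoint
     part. *)
  have d4 : 0 < d / 2 / 2 by rewrite !divr_gt0.
  have /realnormed_closureP/(_ _ d4)[y yX xy] := X_dense xs.
  (* The added 1 allows dividing by the bound even if [lip X y = 0]. *)
  have L0 : 0 < lip X y + 1 by rewrite ltr_pwDr// X_ge0.
  exists (lip X y + 1) => [|phi psi r h]; first exact: ltW.
  have -> : phi x - psi x = (phi (x - y) - psi (x - y)) + (phi y - psi y).
    by rewrite !linearB /=; ring.
  rewrite (le_trans (ler_normcD _ _))// lerD//.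
    rewrite (le_trans (state_bounded _ _ _))// [leRHS]splitr -[X in _ <= X]mulr2n.
    by rewrite mulr_natl lerMn2r /= ltW.
  by apply: state_dist_scale; rewrite // lerDl.
have [K K0 bK] := sa_case b bs; have [K' K'0 cK] := sa_case c cs.
exists (K + K') => [|phi psi r h]; first exact: addr_ge0.
rewrite !stateD !stateZ opprD addrACA -mulrBr.
rewrite (le_trans (ler_normcD _ _))// normcM.
have -> : normc ('i%C : R[i]) = 1 by rewrite /= expr0n add0r expr1n sqrtr1.
by rewrite mul1r mulrDl [d in leRHS]splitr addrACA lerD// (bK, cK).
Qed.

(** Density already makes [mk] separate states and puts [mk]-balls inside weak balls, so only a
    finite diameter and the reverse inclusion have to be supplied. *)
Lemma metrizes_mk :
  (exists M, forall phi psi, (mk phi psi <= M%:E)%E) ->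
  (forall phi e, 0 < e -> exists s d, 0 < d /\
     weak_ball phi s d `<=` [set psi | (mk phi psi <= e%:E)%E]) ->
  metrizes (@mk R X).
Proof.
move=> [M hM] hloc.
have mk0 phi psi : (0 <= mk phi psi)%E.
  apply: le_trans (mk_ge phi psi lipball0).
  by rewrite lee_fin normc_ge0.
have mkfin phi psi : mk phi psi \is a fin_num.
  by rewrite ge0_fin_numE// (le_lt_trans (hM _ _))// ltry.
split => //.
- move=> phi psi; split => [h|->]; last first.
    apply/eqP; rewrite eq_le mk0 andbT; apply/mk_leP => a _.
    by rewrite subrr normc0.
  apply: state_ext => a; apply/eqP; rewrite -subr_eq0; apply/eqP/eq0_normc/eqP.
  rewrite eq_le normc_ge0 andbT; apply/ler_addgt0Pr => d d0.
  have [K K0 /(_ phi psi 0)] := state_dist_approx a d0.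
  by rewrite h lexx mulr0 add0r addr0; apply.
- exact: mkC.
- move=> x y z; rewrite -(fineK (mkfin x y)) -(fineK (mkfin y z)) -EFinD.
  apply/mk_leP => a aX; rewrite -[x a](subrK (y a)) -addrA.
  rewrite (le_trans (ler_normcD _ _))// lerD//.
    by move: a aX; apply/mk_leP; rewrite fineK.
  by move: a aX; apply/mk_leP; rewrite fineK.
move=> phi U; split.
  move=> /weak_nbhsP[s [d [d0 sU]]].
  suff [e e0 eP] : exists2 e, 0 < e & forall psi,
      (mk phi psi < e%:E)%E -> weak_ball phi s d psi.
    by exists e => // psi /eP/sU.
  elim: s {sU} => [|a s [e e0 IH]]; first by exists 1.
  have [K K0 aK] := state_dist_approx a (divr_gt0 d0 (ltr0Sn R 1)).
  have e1 : 0 < d / 2 / (K + 1) by rewrite !divr_gt0// ltr_pwDr.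
  exists (Num.min e (d / 2 / (K + 1))) => [|psi]; first by rewrite lt_min e0.
  rewrite -(fineK (mkfin phi psi)) lte_fin lt_min => /andP[h1 h2].
  rewrite weak_ball_cons; split => /=; last first.
    by apply: IH; rewrite -(fineK (mkfin phi psi)) lte_fin.
  have := aK phi psi (fine (mk phi psi)); rewrite fineK// => /(_ (lexx _)).
  rewrite -normcN opprB => /le_lt_trans; apply; rewrite [ltRHS]splitr ltrD2l.
  move: h2; rewrite ltr_pdivlMr ?ltr_pwDr// mulrC; apply: le_lt_trans.
  rewrite ler_wpM2r ?lerDl// -lee_fin fineK//.
move=> [e e0 eU]; apply/weak_nbhsP.
have [s [d [d0 sd]]] := hloc phi (e / 2) (divr_gt0 e0 (ltr0Sn R 1)).
exists s, d; split => // psi /sd /= h; apply: eU => /=.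
apply: le_lt_trans h _; rewrite lte_fin ltr_pdivrMr// mulr_natr.
by rewrite mulr2n ltrDl.
Qed.

End criterion.

Lemma exists_bound (T : eqType) (s : seq T) (f : T -> R) : exists2 C, 0 <= C &
  forall x, x \in s -> f x <= C.
Proof.
elim: s => [|x s [C C0 sC]]; first by exists 0.
exists (Num.max (f x) C) => [|y]; first by rewrite le_max C0 orbT.
rewrite inE => /orP[/eqP->|/sC yC]; first by rewrite le_max lexx.
by rewrite le_max yC orbT.
Qed.

Hypothesis X_metrizes : metrizes (@mk R X).

Lemma metrizes_weak_ball phi e : 0 < e -> exists s d, 0 < d /\
  weak_ball phi s d `<=` [set psi | (mk phi psi < e%:E)%E].
Proof.
move=> e0; case: X_metrizes => _ _ _ _ h.
by apply/weak_nbhsP/h; exists e.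
Qed.

(* The diameter is finite even though finiteness of [mk] is only assumed
   pointwise: [(1 - t) phi + t psi] lies in a given weak* neighbourhood of
   [phi] for a [t > 0] that does not depend on [psi]. *)
Lemma mk_diameter phi : exists2 M, 0 <= M &
  forall psi psi', (mk psi psi' <= M%:E)%E.
Proof.
have [s [d [d0 sd]]] := metrizes_weak_ball phi ltr01.
have [C C0 sC] := exists_bound s (@cnorm R X).
pose t := Num.min 1 (d / 2 / (C + 1)).
have C1 : 0 < C + 1 by rewrite ltr_pwDr.
have t0 : 0 < t by rewrite lt_min ltr01 !divr_gt0.
have t1 : 0 <= 1 - t by rewrite subr_ge0 ge_min lexx.
have psi_le psi a : lipball a -> normc (phi a - psi a) <= t^-1.
  move=> aX; pose nu := mix phi psi t1 (ltW t0) (subrK t 1).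
  have nuE b : nu b - phi b = t%:C%C * (psi b - phi b).
    by rewrite /= /mix_fun (rmorphB (real_complex R)); ring.
  have : (mk phi nu <= 1%:E)%E.
    apply/ltW/sd => b bs; rewrite nuE normcM normcr (gtr0_norm t0).
    rewrite (@le_lt_trans _ _ (t * (2 * C)))//.
      rewrite ler_wpM2l ?(ltW t0)// (le_trans (state_bounded _ _ _))//.
      by rewrite ler_wpM2l// sC.
    rewrite (@le_lt_trans _ _ (d / 2 / (C + 1) * (2 * C)))//.
      by rewrite ler_wpM2r ?mulr_ge0// ge_min lexx orbT.
    have -> : d / 2 / (C + 1) * (2 * C) = d * (C / (C + 1)) by field; rewrite gt_eqF.
    by rewrite gtr_pMr// ltr_pdivrMr// mul1r ltrDl.
  move=> /mk_leP/(_ a aX); rewrite -normcN opprB nuE normcM normcr (gtr0_norm t0).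
  by rewrite -normcN opprB mulrC -ler_pdivlMr// mul1r.
exists (t^-1 + t^-1) => [|psi psi']; first by rewrite addr_ge0// invr_ge0 ltW.
apply/mk_leP => a aX; rewrite -[psi a](subrK (phi a)) -addrA.
rewrite (le_trans (ler_normcD _ _))// lerD ?psi_le//.
by rewrite -normcN opprB psi_le.
Qed.

(** The estimate for one summand of a state of a direct sum, where only the weighted functional
    [t psi] is observed. If [t0 = 0], a small [t] multiplies the finite diameter; if [t0 > 0], [t]
    stays away from 0 and [psi] itself is weak* close to [phi]. *)
Lemma mk_local phi t0 e : 0 <= t0 -> 0 < e -> exists (s : seq X) (eta : R), 0 < eta /\
  forall psi t, 0 <= t -> `|t - t0| < eta ->
    (forall a, a \in s -> normc (t%:C%C * psi a - t0%:C%C * phi a) < eta) ->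
    forall a, lipball a -> t * normc (psi a - phi a) <= e.
Proof.
move=> t0_ge0 e0.
have [t00|t0n] := eqVneq t0 0.
  have [M M0 hM] := mk_diameter phi.
  have M1 : 0 < M + 1 by rewrite ltr_pwDr.
  exists [::], (e / (M + 1)); split => [|psi t tge0]; first by rewrite divr_gt0.
  rewrite t00 subr0 ger0_norm// => te _ a aX.
  rewrite (@le_trans _ _ (t * (M + 1)))//; last by rewrite -ler_pdivlMr// ltW.
  rewrite ler_wpM2l// (@le_trans _ _ M) ?lerDl//.
  by move: a aX; apply/mk_leP.
have t0p : 0 < t0 by rewrite lt_def t0n.
have t1p : 0 < t0 + 1 by rewrite ltr_pwDr.
(* The distance will be multiplied by [t <= t0 + 1]. *)
have [s [d [d0 sd]]] := metrizes_weak_ball phi (divr_gt0 e0 t1p).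
have [C C0 sC] := exists_bound s (@cnorm R X).
have C1 : 0 < 1 + C by rewrite ltr_pwDl.
(* The three bounds serve [t <= t0 + 1], [t >= t0 / 2], and [eta (1 + C) <= t d], where [eta C] pays
   for replacing [t0] by [t] in front of [phi]. *)
pose eta := Num.min 1 (Num.min (t0 / 2) (d * (t0 / 2) / (1 + C))).
exists s, eta; split => [|psi t tge0 tt0 ts a aX].
  by rewrite !lt_min ltr01 !divr_gt0// !mulr_gt0// invr_gt0.
have [eta1 eta2 eta3] : [/\ eta <= 1, eta <= t0 / 2 & eta <= d * (t0 / 2) / (1 + C)].
  by split; rewrite !ge_min lexx ?orbT.
have tlow : t0 / 2 <= t.
  have : t0 - t <= t0 / 2 
    by rewrite (le_trans (ler_norm _))// distrC (le_trans (ltW tt0)).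
  lra.
have tp : 0 < t by rewrite (lt_le_trans _ tlow)// divr_gt0.
have tup : t <= t0 + 1.
  rewrite -lerBlDl (le_trans (ler_norm _))// (le_trans (ltW tt0))//.
have : weak_ball phi s d psi.
  move=> b bs; rewrite -(ltr_pM2l tp).
  have -> : t * normc (psi b - phi b) = normc (t%:C%C * (psi b - phi b)).
    by rewrite normcM normcr gtr0_norm.
  have -> : t%:C%C * (psi b - phi b) =
     (t%:C%C * psi b - t0%:C%C * phi b) + (t0 - t)%:C%C * phi b.
    by rewrite (rmorphB (real_complex R)); ring.
  rewrite (le_lt_trans (ler_normcD _ _))// normcM normcr distrC.
  rewrite (@lt_le_trans _ _ (eta * (1 + C)))//.
    rewrite mulrDr mulr1 ltr_leD ?ts// ler_pM ?normc_ge0 ?(ltW tt0)//.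
    by rewrite (le_trans (state_le _ _))// sC.
  rewrite -ler_pdivlMr// (le_trans eta3)// ler_wpM2r ?invr_ge0 ?(ltW C1)//.
  by rewrite mulrC ler_wpM2r// ltW.
move=> /sd /= /ltW /mk_leP /(_ _ aX); rewrite -normcN opprB => h.
rewrite (le_trans (ler_wpM2l tge0 h))// mulrCA ger_pMr// ler_pdivrMr//.
by rewrite mul1r.
Qed.

End monge_kantorovich.

(** * Gluing tunnels *)

Section quantum_isometry.
Variables (R : realType) (X Y : lipPair R) (p : {lrmorphism X -> Y}).

Lemma qi_lip_le : quantum_isometry p ->
  forall a, lipdom X a -> lip Y (p a) <= lip X a.
Proof.
move=> qp a aX; rewrite -lee_fin (qi_lip qp (qi_dom qp aX)).
by apply: ereal_inf_lbound; exists a.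
Qed.

Lemma qi_lift : quantum_isometry p -> forall b (r : R), lipdom Y b ->
  lip Y b < r -> exists a, [/\ lipdom X a, p a = b & lip X a < r].
Proof.
move=> qp b r bY; rewrite -lte_fin (qi_lip qp bY) => /ereal_inf_lt[_ [a [aX ab] <-]].
by rewrite lte_fin => ar; exists a.
Qed.

(** The quotient seminorm is an infimum that need not be attained, so lifts with any bound
    [r > lip Y b] are enough. *)
Lemma quantum_isometryP : star_preserving p ->
  (forall b, exists a, p a = b) ->
  (forall a, lipdom X a -> lipdom Y (p a) /\ lip Y (p a) <= lip X a) ->
  (forall b (r : R), lipdom Y b -> lip Y b < r ->
     exists a, [/\ lipdom X a, p a = b & lip X a <= r]) ->
  quantum_isometry p.
Proof.
move=> ps psurj pdom plift; split => // [a /pdom[]//|b bY].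
apply/eqP; rewrite eq_le; apply/andP; split.
  by apply: le_ereal_inf_tmp => _ [a [aX <-] <-]; rewrite lee_fin; case: (pdom a aX).
apply/lee_addgt0Pr => e e0; rewrite -EFinD.
have [|a [aX ab ae]] := plift b (lip Y b + e) bY; first by rewrite ltrDl.
by apply: ereal_inf_le; exists (lip X a)%:E; [exists a|rewrite lee_fin].
Qed.

Hypothesis ps : star_preserving p.

(** The range lies inside the whole state space, so one of the two suprema is 0. *)
Lemma hausdorff_le (r : \bar R) :
  (forall phi : state X, mk phi phi = 0%E) -> (0 <= r)%E ->
  (forall phi : state X, exists psi, (mk phi (pullback ps psi) <= r)%E) ->
  (hausdorff_dist (@mk R X) setT (range (pullback ps)) <= r)%E.
Proof.
move=> mk0 r0 h; rewrite ge_max; apply/andP; split.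
  apply: ge_ereal_sup => _ [phi _ <-]; have [psi hpsi] := h phi.
  apply: ereal_inf_le; exists (mk phi (pullback ps psi)) => //.
  by exists (pullback ps psi) => //; exists psi.
apply: ge_ereal_sup => _ [phi _ <-].
by apply: ereal_inf_le; exists (mk phi phi); [exists phi|rewrite mk0].
Qed.

Lemma hausdorff_lt (r : \bar R) :
  (hausdorff_dist (@mk R X) setT (range (pullback ps)) < r)%E ->
  forall phi : state X, exists psi, (mk phi (pullback ps psi) < r)%E.
Proof.
rewrite gt_max => /andP[h _] phi.
have : (ereal_inf [set mk phi y | y in range (pullback ps)] < r)%E.
  by apply: le_lt_trans h; apply: ereal_sup_ubound; exists phi.
by move=> /ereal_inf_lt[_ [_ [psi _ <-] <-] hr]; exists psi.
Qed.

End quantum_isometry.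

Lemma scaled_state (R : realType) (A : cstarAlgType R) (f : {scalar A})
    (s : R) (phi0 : state A) :
  (forall a, 0 <= f (star a * a)) -> f 1 = s%:C%C ->
  exists phi : state A, forall a, f a = s%:C%C * phi a.
Proof.
move=> f0 f1; have s0 : 0 <= s.
  by have := f0 1; rewrite star1 mulr1 f1 => /gec0_real[t t0 [->]].
have [s00|sn] := eqVneq s 0.
  (* Mass zero forces [f = 0], and then any state is a witness. *)
  exists phi0 => a; have := functional_le f0 a f1; rewrite s00 mul0r mul0r => h.
  by apply: eq0_normc; apply/eqP; rewrite eq_le h normc_ge0.
have sC : s%:C%C != 0 :> R[i] by rewrite (fmorph_eq0 (real_complex R)).
pose g a : R[i] := (s^-1)%:C%C * f a.
have glin : scalar g by move=> c a b; rewrite /g linearP /=; ring.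
pose G : {scalar A} := HB.pack g (GRing.isLinear.Build R[i] A R[i] *%R g glin).
have G0 a : 0 <= G (star a * a) by rewrite mulr_ge0 ?f0// lecR invr_ge0.
have G1 : G 1 = 1 by rewrite /= /g f1 -(rmorphM (real_complex R)) mulVf.
exists (State G0 G1) => a; rewrite /= /g mulrA -(rmorphM (real_complex R)).
by rewrite mulfV// mul1r.
Qed.

Section product_states.
Variables (R : realType) (A B : cstarAlgType R).

(** The restrictions of [phi] to the two summands are positive functionals of masses [s] and [t];
    [phiA] and [phiB] fill in when a mass is zero. *)
Lemma pair_state (phiA : state A) (phiB : state B) (phi : state (A * B)%type) :
  exists s t (phi1 : state A) (phi2 : state B), [/\ 0 <= s, 0 <= t, s + t = 1 &
    forall x, phi x = s%:C%C * phi1 x.1 + t%:C%C * phi2 x.2].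
Proof.
pose f (a : A) : R[i] := phi (a, 0); pose g (b : B) : R[i] := phi (0, b).
have flin : scalar f.
  by move=> c a b; rewrite /f -stateZ -stateD; congr (phi (_, _));
    rewrite /= ?scaler0 ?addr0.
have glin : scalar g.
  by move=> c a b; rewrite /g -stateZ -stateD; congr (phi (_, _));
    rewrite /= ?scaler0 ?addr0.
pose F : {scalar A} := HB.pack f (GRing.isLinear.Build R[i] A R[i] *%R f flin).
pose G : {scalar B} := HB.pack g (GRing.isLinear.Build R[i] B R[i] *%R g glin).
have F0 a : 0 <= F (star a * a).
  have := state_ge0 phi (a, 0); congr (0 <= phi (_, _)); exact: mulr0.
have G0 b : 0 <= G (star b * b).
  have := state_ge0 phi (0, b); congr (0 <= phi (_, _)); exact: mulr0.
have := F0 1; rewrite star1 mulr1 => /gec0_real[s s0 sE].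
have := G0 1; rewrite star1 mulr1 => /gec0_real[t t0 tE].
have [phi1 h1] := scaled_state phiA F0 sE.
have [phi2 h2] := scaled_state phiB G0 tE.
have phiE x : phi x = f x.1 + g x.2.
  by rewrite /f /g -stateD; congr (phi _); case: x => a b; congr (_, _);
    rewrite /= ?addr0 ?add0r.
exists s, t, phi1, phi2; split => //; last by move=> x; rewrite phiE; congr (_ + _).
have := state1 phi; rewrite phiE; rewrite -[f _]/(F 1) -[g _]/(G 1) sE tE.
by rewrite -(rmorphD (real_complex R)) => -[].
Qed.

End product_states.

Section jordan_lie_norm.
Variables (R : realType) (A : cstarAlgType R).
Implicit Types x y u v : A.

Lemma cnorm_mulB x y u v :
  cnorm (x * y - u * v) <= cnorm (x - u) * cnorm y + cnorm u * cnorm (y - v).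
Proof.
have -> : x * y - u * v = (x - u) * y + u * (y - v).
  by rewrite mulrBl mulrBr addrA subrK.
by rewrite (le_trans (cnormD _ _))// lerD ?cnormM.
Qed.

(** Jordan and Lie products are both a scalar of modulus 1/2 times a sum of two terms, so a common
    bound on the terms passes to them without loss. *)
Lemma cnorm_half_sum (c : R[i]) u v (r : R) : normc c = 2^-1 ->
  cnorm u <= r -> cnorm v <= r -> cnorm (c *: (u + v)) <= r.
Proof.
move=> cE ur vr; rewrite cnormZ cE ler_pdivrMl// mulr_natl mulr2n.
by rewrite (le_trans (cnormD _ _))// lerD.
Qed.

Lemma cnorm_jordanB x y u v (r : R) :
  cnorm (x * y - u * v) <= r -> cnorm (y * x - v * u) <= r ->
  cnorm (jordan x y - jordan u v) <= r.
Proof.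
move=> h1 h2; rewrite /jordan -scalerBr opprD addrACA cnorm_half_sum//.
have -> : (2^-1 : R[i]) = (2^-1 : R)%:C%C 
  by rewrite (fmorphV (real_complex R)) (rmorph_nat (real_complex R)).
by rewrite normcr gtr0_norm.
Qed.

Lemma cnorm_lieB x y u v (r : R) :
  cnorm (x * y - u * v) <= r -> cnorm (y * x - v * u) <= r ->
  cnorm (lie x y - lie u v) <= r.
Proof.
move=> h1 h2; rewrite /lie -scalerBr opprD opprK addrACA.
rewrite cnorm_half_sum//; last by rewrite addrC cnorm_distC.
rewrite normcV normcM.
have -> : normc (2 : R[i]) = 2 by rewrite -(rmorph_nat (real_complex R)) normcr ger0_norm.
by rewrite /= expr0n add0r expr1n sqrtr1 mulr1.
Qed.

End jordan_lie_norm.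

Lemma morphZ (R : realType) (A B : cstarAlgType R) (f : {lrmorphism A -> B})
  (c : R[i]) (a : A) : f (c *: a) = c *: f a.
Proof. exact: linearZ. Qed.

Lemma morph_jordan (R : realType) (A B : cstarAlgType R) (f : {lrmorphism A -> B})
  (a b : A) : f (jordan a b) = jordan (f a) (f b).
Proof. by rewrite /jordan morphZ rmorphD !rmorphM. Qed.

Lemma morph_lie (R : realType) (A B : cstarAlgType R) (f : {lrmorphism A -> B})
  (a b : A) : f (lie a b) = lie (f a) (f b).
Proof. by rewrite /lie morphZ rmorphB !rmorphM. Qed.

(** * Algebraic and Leibniz properties of the glued seminorm *)

Section glue.
Variables (R : realType) (D1 D2 : lipPair R) (B : cstarAlgType R).
Variables (pi1 : {lrmorphism D1 -> B}) (pi2 : {lrmorphism D2 -> B}).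
Variable eps : R.
Hypotheses (D1_qcms : is_qcms D1) (D2_qcms : is_qcms D2).
Hypotheses (pi1_le : forall a, cnorm (pi1 a) <= cnorm a)
  (pi2_le : forall a, cnorm (pi2 a) <= cnorm a) (eps0 : 0 < eps).

Definition glue_dom : set (D1 * D2)%type :=
  [set x | lipdom D1 x.1 /\ lipdom D2 x.2].

Definition glue_lip (x : (D1 * D2)%type) : R :=
  Num.max (Num.max (lip D1 x.1) (lip D2 x.2)) (cnorm (pi1 x.1 - pi2 x.2) / eps).

Definition glue : lipPair R := LipPair glue_dom glue_lip.

Implicit Types x y : (D1 * D2)%type.

Lemma glue_lip_le x (r : R) : glue_lip x <= r <->
  [/\ lip D1 x.1 <= r, lip D2 x.2 <= r & cnorm (pi1 x.1 - pi2 x.2) <= r * eps].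
Proof.
rewrite !ge_max ler_pdivrMr//; split; first by move=> /andP[/andP[]].
by move=> [-> -> ->].
Qed.

Lemma glue_lipP x : [/\ lip D1 x.1 <= glue_lip x, lip D2 x.2 <= glue_lip x
  & cnorm (pi1 x.1 - pi2 x.2) <= glue_lip x * eps].
Proof. exact/glue_lip_le. Qed.

Lemma glue_ballP x : lipball (X := glue) x <->
  [/\ lipball x.1, lipball x.2 & cnorm (pi1 x.1 - pi2 x.2) <= eps].
Proof.
split=> [[[x1 x2] /glue_lip_le[]]|[[x1 h1] [x2 h2] h3]]; rewrite ?mul1r//.
by split => //; apply/glue_lip_le; rewrite mul1r.
Qed.

Lemma glue_jls : jordan_lie_subalgebra (lipdom glue).
Proof.
have [s1 z1 d1 c1 j1 l1] := qcms_dom D1_qcms.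
have [s2 z2 d2 c2 j2 l2] := qcms_dom D2_qcms.
split=> //.
- by move=> [a b] [/s1 /= as_ /s2 /= bs]; congr (_, _).
- by move=> x y [? ?] [? ?]; split; [exact: d1|exact: d2].
- by move=> t x [? ?]; split; [exact: c1|exact: c2].
- by move=> x y [? ?] [? ?]; split; [exact: j1|exact: j2].
- by move=> x y [? ?] [? ?]; split; [exact: l1|exact: l2].
Qed.

Lemma glue_dense :
  @selfadjoint R glue `<=` closure (lipdom glue : set (realnormed glue)).
Proof.
move=> [a b] [as_ bs]; apply/realnormed_closureP => e e0.
have /realnormed_closureP/(_ _ e0)[a' a'X aa'] := qcms_dense D1_qcms as_.
have /realnormed_closureP/(_ _ e0)[b' b'X bb'] := qcms_dense D2_qcms bs.
by exists (a', b') => //=; rewrite gt_max /= aa'.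
Qed.

Lemma glue_lip_ge0 x : lipdom glue x -> 0 <= lip glue x.
Proof. by move=> [x1 _]; rewrite !le_max (lip_ge0 D1_qcms x1). Qed.

Lemma glue_lipZ (t : R) x : lipdom glue x ->
  lip glue (t%:C%C *: x) = `|t| * lip glue x.
Proof.
move=> [x1 x2]; rewrite /= /glue_lip /= !lipZ// !morphZ -scalerBr cnormZr -mulrA.
by rewrite -!maxr_pMr.
Qed.

Lemma glue_lipD x y : lipdom glue x -> lipdom glue y ->
  lip glue (x + y) <= lip glue x + lip glue y.
Proof.
move=> [x1 x2] [y1 y2]; have [a1 a2 a3] := glue_lipP x; have [b1 b2 b3] := glue_lipP y.
apply/glue_lip_le; split.
- by rewrite (le_trans (lipD D1_qcms x1 y1))// lerD.
- by rewrite (le_trans (lipD D2_qcms x2 y2))// lerD.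
by rewrite !rmorphD opprD addrACA (le_trans (cnormD _ _))// mulrDl lerD.
Qed.

Lemma glue_lip_eq0 : [set x | lipdom glue x /\ lip glue x = 0] =
  [set t%:C%C *: (1 : glue) | t in [set: R]].
Proof.
have z1 := lip_eq0 D1_qcms; have z2 := lip_eq0 D2_qcms.
apply/seteqP; split.
  move=> [a b] [[/= a1 b1] ab0]; have [] := glue_lipP (a, b).
  rewrite /= [glue_lip _]ab0 mul0r => a0 b0 pab.
  have [s _ sa] : [set t%:C%C *: (1 : D1) | t in [set: R]] a.
    by rewrite -z1; split => //; apply/eqP; rewrite eq_le a0 lip_ge0.
  have [t _ tb] : [set t%:C%C *: (1 : D2) | t in [set: R]] b.
    by rewrite -z2; split => //; apply/eqP; rewrite eq_le b0 lip_ge0.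
  (* The gluing term forces the scalars [s] and [t] to agree, since [pi1] and [pi2] are unital. *)
  move: pab; rewrite -sa -tb !morphZ !rmorph1 -scalerBl -(rmorphB (real_complex R)).
  rewrite cnormZr cnorm1 mulr1 normr_le0 subr_eq0 => /eqP st.
  by exists s => //; rewrite st.
move=> _ [t _ <-].
have [t1 t10] : [set a | lipdom D1 a /\ lip D1 a = 0] (t%:C%C *: 1).
  by rewrite z1; exists t.
have [t2 t20] : [set a | lipdom D2 a /\ lip D2 a = 0] (t%:C%C *: 1).
  by rewrite z2; exists t.
split => //; rewrite /= /glue_lip /= t10 t20 !morphZ !rmorph1 subrr cnorm0 mul0r.
by rewrite !maxxx.
Qed.

(** For the gluing term, telescope [pi1 x1 pi1 y1 - pi2 x2 pi2 y2] through [pi2 x2 pi1 y1];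
    contractivity bounds the remaining factors by the norms of [x] and [y]. *)
Lemma glue_leibniz x y : lipdom glue x -> lipdom glue y ->
  Num.max (lip glue (jordan x y)) (lip glue (lie x y))
    <= lip glue x * cnorm y + cnorm x * lip glue y.
Proof.
move=> [x1 x2] [y1 y2].
have [a1 a2 a3] := glue_lipP x; have [b1 b2 b3] := glue_lipP y.
have [x0 y0] : 0 <= glue_lip x /\ 0 <= glue_lip y by split; exact: glue_lip_ge0.
have [nx1 nx2] := (pair_cnorm_le1 x, pair_cnorm_le2 x).
have [ny1 ny2] := (pair_cnorm_le1 y, pair_cnorm_le2 y).
have le1 : lip D1 x.1 * cnorm y.1 + cnorm x.1 * lip D1 y.1 <=
   glue_lip x * cnorm y + cnorm x * glue_lip y.
  by rewrite lerD// ler_pM ?cnorm_ge0 ?(lip_ge0 D1_qcms).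
have le2 : lip D2 x.2 * cnorm y.2 + cnorm x.2 * lip D2 y.2 <=
   glue_lip x * cnorm y + cnorm x * glue_lip y.
  by rewrite lerD// ler_pM ?cnorm_ge0 ?(lip_ge0 D2_qcms).
have := lip_leibniz D1_qcms x1 y1; rewrite ge_max => /andP[j1 l1].
have := lip_leibniz D2_qcms x2 y2; rewrite ge_max => /andP[j2 l2].
have pxy : cnorm (pi1 x.1 * pi1 y.1 - pi2 x.2 * pi2 y.2) <=
    (glue_lip x * cnorm y + cnorm x * glue_lip y) * eps.
  have -> : (glue_lip x * cnorm y + cnorm x * glue_lip y) * eps =
    (glue_lip x * eps) * cnorm y + cnorm x * (glue_lip y * eps) by ring.
  rewrite (le_trans (cnorm_mulB _ _ _ _))// lerD// ler_pM ?cnorm_ge0//.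
    exact: le_trans (pi1_le _) ny1.
  exact: le_trans (pi2_le _) nx2.
have pyx : cnorm (pi1 y.1 * pi1 x.1 - pi2 y.2 * pi2 x.2) <=
    (glue_lip x * cnorm y + cnorm x * glue_lip y) * eps.
  have -> : (glue_lip x * cnorm y + cnorm x * glue_lip y) * eps =
    (glue_lip y * eps) * cnorm x + cnorm y * (glue_lip x * eps) by ring.
  rewrite (le_trans (cnorm_mulB _ _ _ _))// lerD// ler_pM ?cnorm_ge0//.
    exact: le_trans (pi1_le _) nx1.
  exact: le_trans (pi2_le _) ny2.
rewrite ge_max; apply/andP; split; apply/glue_lip_le; split.
- exact: le_trans j1 le1.
- exact: le_trans j2 le2.
- by rewrite !morph_jordan cnorm_jordanB.
- exact: le_trans l1 le1.
- exact: le_trans l2 le2.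
- by rewrite !morph_lie cnorm_lieB.
Qed.

Lemma glue_closed :
  closed ([set x | lipdom glue x /\ lip glue x <= 1] : set (realnormed glue)).
Proof.
have /realnormed_closedP c1 := lip_closed D1_qcms.
have /realnormed_closedP c2 := lip_closed D2_qcms.
apply/realnormed_closedP => x xcl; apply/glue_ballP.
have xcl' e : 0 < e -> exists y,
    [/\ lipball y.1, lipball y.2, cnorm (pi1 y.1 - pi2 y.2) <= eps,
     cnorm (x.1 - y.1) < e & cnorm (x.2 - y.2) < e].
  move=> /xcl[y /glue_ballP[y1 y2 y3] xy]; exists y; split => //.
    exact: le_lt_trans (pair_cnorm_le1 (x - y)) xy.
  exact: le_lt_trans (pair_cnorm_le2 (x - y)) xy.
split.
- by apply: c1 => e /xcl'[y [? ? ? ? ?]]; exists y.1.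
- by apply: c2 => e /xcl'[y [? ? ? ? ?]]; exists y.2.
apply/ler_addgt0Pr => e e0.
have [y [_ _ y3 xy1 xy2]] := xcl' (e / 2) (divr_gt0 e0 (ltr0Sn R 1)).
have -> : pi1 x.1 - pi2 x.2 = (pi1 y.1 - pi2 y.2) + (pi1 (x.1 - y.1) - pi2 (x.2 - y.2)).
  by rewrite !rmorphB opprB addrACA [pi1 y.1 + _]addrC subrK addKr.
rewrite (le_trans (cnormD _ _))// lerD// (le_trans (cnormD _ _))// cnormN [leRHS]splitr.
by rewrite lerD// ltW// (le_lt_trans (pi1_le _), le_lt_trans (pi2_le _)).
Qed.

Lemma glue_strongly_leibniz :
  strongly_leibniz D1 -> strongly_leibniz D2 -> strongly_leibniz glue.
Proof.
move=> S1 S2 x y xy yx [x1 x2].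
have xy1 : x.1 * y.1 = 1 by exact: (congr1 fst xy).
have xy2 : x.2 * y.2 = 1 by exact: (congr1 snd xy).
have yx1 : y.1 * x.1 = 1 by exact: (congr1 fst yx).
have yx2 : y.2 * x.2 = 1 by exact: (congr1 snd yx).
have [y1 ly1] := S1 _ _ xy1 yx1 x1; have [y2 ly2] := S2 _ _ xy2 yx2 x2.
have [a1 a2 a3] := glue_lipP x.
have [ny1 ny2] := (pair_cnorm_le1 y, pair_cnorm_le2 y).
split => //; apply/glue_lip_le; split.
- rewrite (le_trans ly1)// ler_pM ?sqr_ge0 ?(lip_ge0 D1_qcms)//.
  by rewrite ler_pXn2r// nnegrE ?cnorm_ge0.
- rewrite (le_trans ly2)// ler_pM ?sqr_ge0 ?(lip_ge0 D2_qcms)//.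
  by rewrite ler_pXn2r// nnegrE ?cnorm_ge0.
(* The resolvent identity [u^-1 - v^-1 = - u^-1 (u - v) v^-1]; each outer factor contributes one
   [cnorm y]. *)
have -> : pi1 y.1 - pi2 y.2 = - (pi1 y.1 * (pi1 x.1 - pi2 x.2) * pi2 y.2).
  rewrite mulrBr mulrBl -rmorphM yx1 rmorph1 mul1r -mulrA -rmorphM xy2 rmorph1 mulr1.
  by rewrite opprB.
have -> : cnorm y ^+ 2 * glue_lip x * eps =
  (cnorm y * (glue_lip x * eps)) * cnorm y by ring.
rewrite cnormN (le_trans (cnormM _ _))// ler_pM ?cnorm_ge0//.
  rewrite (le_trans (cnormM _ _))// ler_pM ?cnorm_ge0//.
  exact: le_trans (pi1_le _) ny1.
exact: le_trans (pi2_le _) ny2.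
Qed.

End glue.

(** * The glued seminorm metrizes the weak* topology *)

Section glue_metrizes.
Variables (R : realType) (D1 D2 : lipPair R) (B : cstarAlgType R).
Variables (pi1 : {lrmorphism D1 -> B}) (pi2 : {lrmorphism D2 -> B}).
Variables (eps : R) (phiB : state B).
Hypotheses (D1_qcms : is_qcms D1) (D2_qcms : is_qcms D2).
Hypotheses (pi1s : star_preserving pi1) (pi2s : star_preserving pi2).
Hypotheses (pi1_le : forall a, cnorm (pi1 a) <= cnorm a)
  (pi2_le : forall a, cnorm (pi2 a) <= cnorm a) (eps0 : 0 < eps).
Local Notation D := (glue pi1 pi2 eps).

Lemma state_glue (phi : state D) : exists s t (phi1 : state D1) (phi2 : state D2),
  [/\ 0 <= s, 0 <= t, s + t = 1 &
    forall x, phi x = s%:C%C * phi1 x.1 + t%:C%C * phi2 x.2].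
Proof. exact: (pair_state (pullback pi1s phiB) (pullback pi2s phiB)). Qed.

Lemma dist_pi (psi : state B) (x : D) : lipball x ->
  normc (psi (pi1 x.1) - psi (pi2 x.2)) <= eps.
Proof.
move=> /(glue_ballP _ _ eps0)[_ _ xe]; rewrite -linearB.
exact: le_trans (state_le _ _) xe.
Qed.

(** Pass from [phi1] to [phi2] through [phiB \o pi1] and [phiB \o pi2]: the cost is one diameter in
    each summand and [eps] for the crossing. *)
Lemma glue_cross : exists2 M, 0 <= M &
  forall (phi1 : state D1) (phi2 : state D2) (x : D), lipball x ->
    normc (phi1 x.1 - phi2 x.2) <= M.
Proof.
have [M1 M10 h1] := mk_diameter (lip_metrizes D1_qcms) (pullback pi1s phiB).
have [M2 M20 h2] := mk_diameter (lip_metrizes D2_qcms) (pullback pi2s phiB).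
exists (M1 + (eps + M2)) => [|phi1 phi2 x xX]; first by rewrite !addr_ge0// ltW.
have [x1 x2 xe] := (glue_ballP pi1 pi2 eps0 x).1 xX.
rewrite -[phi1 x.1](subrK (phiB (pi1 x.1))) -addrA (le_trans (ler_normcD _ _))//.
have /mk_leP/(_ _ x1) := h1 phi1 (pullback pi1s phiB).
have /mk_leP/(_ _ x2) := h2 (pullback pi2s phiB) phi2 => k2 k1.
rewrite lerD// -[phiB (pi1 _)](subrK (phiB (pi2 x.2))) -addrA.
by rewrite (le_trans (ler_normcD _ _))// lerD// dist_pi.
Qed.

(** With states written as [s phi1 + t phi2], a weak* neighbourhood controls the weights and the
    weighted components. [mk_local] handles each component, and the change of weights costs at most
    its size times the bound of [glue_cross]. *)
Lemma glue_metrizes : metrizes (@mk R D).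
Proof.
apply: metrizes_mk; first exact: glue_jls.
- exact: glue_dense.
- exact: glue_lip_ge0.
- exact: glue_lipZ.
- have [M M0 hM] := glue_cross.
  have [M1 M10 h1] := mk_diameter (lip_metrizes D1_qcms) (pullback pi1s phiB).
  pose th := pullback pi1s phiB.
  have th_le (phi : state D) x : lipball (X := D) x -> normc (phi x - th x.1) <= M1 + M.
    move=> xX; have [s [t [phi1 [phi2 [s0 t0 st ->]]]]] := state_glue phi.
    have [x1 x2 xe] := (glue_ballP pi1 pi2 eps0 x).1 xX.
    have -> : s%:C%C * phi1 x.1 + t%:C%C * phi2 x.2 - th x.1 =
        s%:C%C * (phi1 x.1 - th x.1) - t%:C%C * (th x.1 - phi2 x.2).
      have -> : t = 1 - s by lra.
      by rewrite (rmorphB (real_complex R)) (rmorph1 (real_complex R)); ring.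
    rewrite (le_trans (ler_normcD _ _))// normcN !normcM !normcr !ger0_norm//.
    have k1 := (mk_leP phi1 th M1).1 (h1 _ _) _ x1; have k2 := hM th phi2 x xX.
    have [s1 t1] : s <= 1 /\ t <= 1 by split; lra.
    by rewrite lerD// -[leRHS]mul1r ler_pM ?normc_ge0.
  exists ((M1 + M) + (M1 + M)) => phi psi; apply/mk_leP => x xX.
  rewrite -[phi x](subrK (th x.1)) -addrA (le_trans (ler_normcD _ _))// lerD ?th_le//.
  by rewrite -normcN opprB th_le.
move=> phi e e0; have [M M0 hM] := glue_cross.
have [s [t [phi1 [phi2 [s0 t0 st phiE]]]]] := state_glue phi.
have e4 : 0 < e / 4 by rewrite divr_gt0.
have [s1 [d1 [d10 h1]]] := mk_local (lip_metrizes D1_qcms) phi1 s0 e4.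
have [s2 [d2 [d20 h2]]] := mk_local (lip_metrizes D2_qcms) phi2 t0 e4.
have M1 : 0 < M + 1 by rewrite ltr_pwDr.
pose d := Num.min (e / 2 / (M + 1)) (Num.min d1 d2).
have [dM dd1 dd2] : [/\ d <= e / 2 / (M + 1), d <= d1 & d <= d2].
  by split; rewrite !ge_min lexx ?orbT.
(* The first two elements read off the weights, the others test the weighted components. *)
exists ((1, 0) :: (0, 1) :: [seq (a, 0) | a <- s1] ++ [seq (0, b) | b <- s2] : seq D), d.
split => [|psi]; first by rewrite !lt_min d10 d20 !divr_gt0.
have [s' [t' [psi1 [psi2 [s'0 t'0 st' psiE]]]]] := state_glue psi.
move=> hpsi; apply/mk_leP => x xX.
have [x1 x2 xe] := (glue_ballP pi1 pi2 eps0 x).1 xX.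
have ss' : `|s' - s| < d.
  have := hpsi (1, 0); rewrite inE eqxx => /(_ isT).
  rewrite phiE psiE /= !state1 (raddf0 phi2) (raddf0 psi2) !mulr0 !addr0 !mulr1.
  by rewrite -(rmorphB (real_complex R)) normcr.
have tt' : `|t' - t| < d.
  have := hpsi (0, 1); rewrite !inE eqxx orbT => /(_ isT).
  rewrite phiE psiE /= !state1 (raddf0 phi1) (raddf0 psi1) !mulr0 !add0r !mulr1.
  by rewrite -(rmorphB (real_complex R)) normcr.
have k1 : s' * normc (psi1 x.1 - phi1 x.1) <= e / 4.
  apply: h1 => //; first exact: lt_le_trans ss' dd1.
  move=> a as1; have := hpsi (a, 0); rewrite !inE mem_cat map_f// !orbT => /(_ isT).
  rewrite phiE psiE /= (raddf0 phi2) (raddf0 psi2) !mulr0 !addr0 => /lt_le_trans; exact.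
have k2 : t' * normc (psi2 x.2 - phi2 x.2) <= e / 4.
  apply: h2 => //; first exact: lt_le_trans tt' dd2.
  move=> a as2; have im : ((0, a) : D) \in ([seq (0, b) | b <- s2] : seq D).
    exact: (map_f (fun b : D2 => ((0, b) : D))).
  have := hpsi (0, a); rewrite !inE mem_cat im !orbT => /(_ isT).
  rewrite phiE psiE /= (raddf0 phi1) (raddf0 psi1) !mulr0 !add0r => /lt_le_trans; exact.
rewrite -normcN opprB phiE psiE.
(* As both pairs of weights sum to 1, [t' - t = -(s' - s)], and the change of weights meets only the
   difference [phi1 - phi2]. *)
have -> : s'%:C%C * psi1 x.1 + t'%:C%C * psi2 x.2 -
    (s%:C%C * phi1 x.1 + t%:C%C * phi2 x.2)
  = s'%:C%C * (psi1 x.1 - phi1 x.1) + t'%:C%C * (psi2 x.2 - phi2 x.2)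
    + (s' - s)%:C%C * (phi1 x.1 - phi2 x.2).
  have -> : s = 1 - t by lra.
  have -> : s' = 1 - t' by lra.
  rewrite !(rmorphB (real_complex R)); ring.
rewrite (le_trans (ler_normcD _ _))//.
rewrite (@le_trans _ _ (e / 4 + e / 4 + e / 2))//; last by lra.
rewrite lerD//.
  rewrite (le_trans (ler_normcD _ _))// !normcM !normcr !ger0_norm// lerD//.
rewrite normcM normcr (@le_trans _ _ (e / 2 / (M + 1) * (M + 1)))//.
  rewrite ler_pM ?normc_ge0 ?(le_trans (ltW ss'))//.
  by rewrite (le_trans (hM _ _ _ xX))// lerDl.
by rewrite divfK// gt_eqF.
Qed.

Lemma glue_qcms : is_qcms D.
Proof.
split.
- exact: glue_jls.
- exact: glue_dense.
- exact: glue_lip_ge0.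
- exact: glue_lipD.
- exact: glue_lipZ.
- exact: glue_lip_eq0.
- exact: glue_metrizes.
- exact: glue_leibniz.
- exact: glue_closed.
Qed.

End glue_metrizes.

Lemma qcms_mk0 (R : realType) (X : lipPair R) : is_qcms X ->
  forall phi : state X, mk phi phi = 0%E.
Proof. by move=> /lip_metrizes[_ h _ _ _] phi; apply/h. Qed.

(* A state of [D1 (+) D2] is close to a state of [X]: move the second component
   to [D1] through [B], then both components from [D1] to [X]. *)
Lemma glue_state_near (R : realType) (D1 D2 : lipPair R) (B X : cstarAlgType R)
    (pi1 : {lrmorphism D1 -> B}) (pi1s : star_preserving pi1)
    (pi2 : {lrmorphism D2 -> B}) (pi2s : star_preserving pi2)
    (p : {lrmorphism D1 -> X}) (ps : star_preserving p) (c1 c2 eps : R) :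
    0 <= c2 -> 0 <= eps ->
    (forall phi : state D1, exists th, (mk phi (pullback ps th) <= c1%:E)%E) ->
    (forall phi : state D2, exists psi, (mk phi (pullback pi2s psi) <= c2%:E)%E) ->
  forall (s t : R) (phi1 : state D1) (phi2 : state D2),
    0 <= s -> 0 <= t -> s + t = 1 ->
  exists th : state X, forall x1 x2, lipball x1 -> lipball x2 ->
    cnorm (pi1 x1 - pi2 x2) <= eps ->
    normc (s%:C%C * phi1 x1 + t%:C%C * phi2 x2 - th (p x1)) <= c1 + (c2 + eps).
Proof.
move=> c20 eps0 h1 h2 s t phi1 phi2 s0 t0 st.
have [th1 k1] := h1 phi1; have [psi k2] := h2 phi2.
have [th2 k3] := h1 (pullback pi1s psi).
exists (mix th1 th2 s0 t0 st) => x1 x2 x1D x2D xe.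
have {}k1 := (mk_leP _ _ _).1 k1 _ x1D; have {}k2 := (mk_leP _ _ _).1 k2 _ x2D.
have {}k3 := (mk_leP _ _ _).1 k3 _ x1D.
have -> : s%:C%C * phi1 x1 + t%:C%C * phi2 x2 - mix th1 th2 s0 t0 st (p x1) =
    s%:C%C * (phi1 x1 - th1 (p x1)) + t%:C%C * (phi2 x2 - th2 (p x1)).
  by rewrite /= /mix_fun; ring.
rewrite (le_trans (ler_normcD _ _))// !normcM !normcr !ger0_norm//.
rewrite (@le_trans _ _ (s * (c1 + (c2 + eps)) + t * (c1 + (c2 + eps))))//; last first.
  by rewrite -mulrDl st mul1r.
rewrite lerD// ler_wpM2l//; first by rewrite (le_trans k1)// lerDl addr_ge0.
have -> : phi2 x2 - th2 (p x1) = (psi (pi1 x1) - th2 (p x1)) +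
    ((phi2 x2 - psi (pi2 x2)) + (psi (pi2 x2) - psi (pi1 x1))) by ring.
rewrite (le_trans (ler_normcD _ _))// lerD// (le_trans (ler_normcD _ _))// lerD//.
by rewrite -linearB (le_trans (state_le _ _))// cnorm_distC.
Qed.

Lemma extent_lt (R : realType) (X1 X2 : lipPair R) (t : tunnel X1 X2) (c : \bar R) :
  (extent t < c)%E ->
  (forall phi, exists psi, (mk phi (pullback (qi_star (tunnel_qi1 t)) psi) <= c)%E) /\
  (forall phi, exists psi, (mk phi (pullback (qi_star (tunnel_qi2 t)) psi) <= c)%E).
Proof.
rewrite gt_max => /andP[h1 h2]; split=> phi.
  by have [psi /ltW] := hausdorff_lt h1 phi; exists psi.
by have [psi /ltW] := hausdorff_lt h2 phi; exists psi.
Qed.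

(** * The tunnel obtained by gluing, and its extent *)

Section triangle.
Variables (R : realType) (B X1 X2 : lipPair R) (t1 : tunnel B X1) (t2 : tunnel B X2).
Variables (phiB : state B) (c1 c2 eps : R).
Hypothesis B_contractive : forall (A : cstarAlgType R) (f : {lrmorphism A -> B}),
  star_preserving f -> forall a, cnorm (f a) <= cnorm a.
Hypotheses (t1_SL : strongly_leibniz (tunnel_space t1))
  (t2_SL : strongly_leibniz (tunnel_space t2)).
Hypotheses (t1_extent : (extent t1 < c1%:E)%E) (t2_extent : (extent t2 < c2%:E)%E).
Hypotheses (c10 : 0 <= c1) (c20 : 0 <= c2) (eps0 : 0 < eps).

Local Notation D1 := (tunnel_space t1).
Local Notation D2 := (tunnel_space t2).
Local Notation pi1 := (tunnel_proj1 t1).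
Local Notation pi2 := (tunnel_proj1 t2).
Let pi1s := qi_star (tunnel_qi1 t1).
Let pi2s := qi_star (tunnel_qi1 t2).
Local Notation D := (glue pi1 pi2 eps).

Let D_qcms : is_qcms D.
Proof.
exact: (glue_qcms phiB (tunnel_qcms t1) (tunnel_qcms t2) pi1s pi2s
  (B_contractive pi1s) (B_contractive pi2s) eps0).
Qed.

Let q1 : {lrmorphism D -> X1} := tunnel_proj2 t1 \o fst.
Let q2 : {lrmorphism D -> X2} := tunnel_proj2 t2 \o snd.

(** Lift [b] to [D1], push the lift to [B] and lift its image to [D2]: the pair has gluing term 0.
    The strict bound [r] survives each move. *)
Let q1_qi : quantum_isometry q1.
Proof.
have qi1 := tunnel_qi2 t1; apply: quantum_isometryP.
- by move=> x; exact: (qi_star qi1).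
- by move=> b; have [a <-] := qi_surj qi1 b; exists (a, 0).
- move=> x [x1 x2]; split; first exact: (qi_dom qi1).
  by have [h _ _] := glue_lipP pi1 pi2 eps0 x; exact: le_trans (qi_lip_le qi1 x1) h.
move=> b r bX br; have [a [aD ab ar]] := qi_lift qi1 bX br.
have aB := qi_dom (tunnel_qi1 t1) aD.
have [|a' [a'D aa' ar']] := qi_lift (tunnel_qi1 t2) aB (r := r).
  exact: le_lt_trans (qi_lip_le (tunnel_qi1 t1) aD) ar.
exists (a, a'); split => //; apply/(glue_lip_le _ _ eps0).
split => /=; [exact: ltW|exact: ltW|].
have r0 : 0 <= r by rewrite (le_trans _ (ltW ar))// (lip_ge0 (tunnel_qcms t1) aD).
by rewrite aa' subrr cnorm0 mulr_ge0// ltW.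
Qed.

Let q2_qi : quantum_isometry q2.
Proof.
have qi2 := tunnel_qi2 t2; apply: quantum_isometryP.
- by move=> x; exact: (qi_star qi2).
- by move=> b; have [a <-] := qi_surj qi2 b; exists (0, a).
- move=> x [x1 x2]; split; first exact: (qi_dom qi2).
  by have [_ h _] := glue_lipP pi1 pi2 eps0 x; exact: le_trans (qi_lip_le qi2 x2) h.
move=> b r bX br; have [a [aD ab ar]] := qi_lift qi2 bX br.
have aB := qi_dom (tunnel_qi1 t2) aD.
have [|a' [a'D aa' ar']] := qi_lift (tunnel_qi1 t1) aB (r := r).
  exact: le_lt_trans (qi_lip_le (tunnel_qi1 t2) aD) ar.
exists (a', a); split => //; apply/(glue_lip_le _ _ eps0).
split => /=; [exact: ltW|exact: ltW|].
have r0 : 0 <= r by rewrite (le_trans _ (ltW ar))// (lip_ge0 (tunnel_qcms t2) aD).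
by rewrite aa' subrr cnorm0 mulr_ge0// ltW.
Qed.

Lemma propinquity_glue : (propinquity_SL X1 X2 <= (c1 + (c2 + eps))%:E)%E.
Proof.
pose t := Tunnel D_qcms q1_qi q2_qi.
have [h11 h12] := extent_lt t1_extent; have [h21 h22] := extent_lt t2_extent.
apply: ereal_inf_le; exists (extent t).
  exists t => //; apply: glue_strongly_leibniz => //.
  - exact: tunnel_qcms.
  - exact: tunnel_qcms.
  - exact: B_contractive.
  - exact: B_contractive.
have C0 : (0 <= (c1 + (c2 + eps))%:E)%E by rewrite lee_fin !addr_ge0// ltW.
have mk0 := qcms_mk0 D_qcms.
rewrite ge_max; apply/andP; split; apply: hausdorff_le => // phi.
  have [s [r [phi1 [phi2 [s0 r0 sr phiE]]]]] := state_glue phiB pi1s pi2s phi.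
  have [th thP] := glue_state_near pi1s c20 (ltW eps0) h12 h21 phi1 phi2 s0 r0 sr.
  exists th; apply/mk_leP => x /(glue_ballP _ _ eps0)[x1 x2 xe].
  by rewrite phiE; exact: thP.
have [s [r [phi1 [phi2 [s0 r0 sr phiE]]]]] := state_glue phiB pi1s pi2s phi.
(* For [X2] the two summands exchange roles in [glue_state_near]. *)
rewrite addrC in sr.
have [th thP] := glue_state_near pi2s c10 (ltW eps0) h22 h11 phi2 phi1 r0 s0 sr.
exists th; apply/mk_leP => x /(glue_ballP _ _ eps0)[x1 x2 xe].
have -> : c1 + (c2 + eps) = c2 + (c1 + eps) by ring.
by rewrite phiE [X in X - _]addrC; apply: thP; rewrite // cnorm_distC.
Qed.

End triangle.

(** * Morphisms from and to matrix algebras *)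

(** For a vector [v], the functional taking [b] to the inner product of [v] and [f b v] is positive
    of mass [|v|^2]. Its bound at [star a * a] reads [|f a v|^2 <= |v|^2 |a|^2]. *)
Lemma matrix_contractive (R : realType) k (A : cstarAlgType R)
    (f : {lrmorphism A -> 'M[R[i]]_k.+1}) :
  star_preserving f -> forall a, cnorm (f a) <= cnorm a.
Proof.
move=> fs a; apply: opnorm_le => [|v]; first exact: cnorm_ge0.
pose phi (b : A) : R[i] := (adjmx v *m (f b *m v)) 0 0.
have philin : scalar phi.
  by move=> c b d; rewrite /phi linearP mulmxDl mulmxDr -scalemxAl -scalemxAr !mxE.
pose Phi : {scalar A} := HB.pack phi (GRing.isLinear.Build R[i] A R[i] *%R phi philin).
have PhiE b : Phi (star b * b) = (l2norm (f b *m v) ^+ 2)%:C%C.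
  rewrite -adjmx_cV adjmxM -mulmxA [adjmx (f b) *m _]mulmxA.
  have -> : adjmx (f b) *m f b = f (star b * b).
    exact: esym (etrans (rmorphM f (star b) b) (congr1 (fun z => z *m f b) (fs b))).
  by [].
have Phi0 b : 0 <= Phi (star b * b) by rewrite PhiE lecR sqr_ge0.
have Phi1 : Phi 1 = (l2norm v ^+ 2)%:C%C.
  by rewrite /= /phi rmorph1 mul1mx adjmx_cV.
have := functional_le Phi0 (star a * a) Phi1.
rewrite PhiE normcr ger0_norm ?sqr_ge0// cnorm_starM -exprMn mulrC.
by rewrite ler_pXn2r// nnegrE ?mulr_ge0 ?cnorm_ge0 ?l2norm_ge0.
Qed.

(** * Removing multiplicative constants from norm estimates by taking powers *)

Section power_trick.
Variable R : realType.

Lemma cnorm_sa_exp (A : cstarAlgType R) (h : A) n : star h = h ->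
  cnorm (h ^+ (2 ^ n)) = cnorm h ^+ (2 ^ n).
Proof.
move=> hs; elim: n => [|n IH]; first by rewrite !expr1.
have hns m : star (h ^+ m) = h ^+ m.
  by elim: m => [|m IHm]; [rewrite expr0 star1|rewrite {1}exprS starM IHm hs -exprSr].
by rewrite expnSr !exprM -IH -cnorm_starM hns expr2.
Qed.

(** If [a > b > 0], Bernoulli makes the powers of [a / b] unbounded, so no constant [K] can dominate
    them. *)
Lemma ler_exp2n_bound (a b K : R) : 0 <= a -> 0 <= b ->
  (forall n, a ^+ (2 ^ n) <= K * b ^+ (2 ^ n)) -> a <= b.
Proof.
move=> a0 b0 h; rewrite leNgt; apply/negP => ba.
have [b00|bn] := eqVneq b 0.
  by have := h 0; rewrite !expr1 b00 mulr0 leNgt -b00 ba.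
have bp : 0 < b by rewrite lt_def bn.
pose d := a / b - 1.
have d0 : 0 < d by rewrite subr_gt0 ltr_pdivlMr// mul1r.
have bernoulli m : 1 + m%:R * d <= (a / b) ^+ m.
  elim: m => [|m IH]; first by rewrite mul0r addr0.
  rewrite exprS (_ : a / b = 1 + d); last by rewrite /d; ring.
  move: IH; rewrite (_ : a / b = 1 + d); last by rewrite /d; ring.
  move=> IH; rewrite (@le_trans _ _ ((1 + d) * (1 + m%:R * d)))//; last first.
    by rewrite ler_wpM2l// addr_ge0// ltW.
  rewrite -natr1 -subr_ge0.
  have -> : (1 + d) * (1 + m%:R * d) - (1 + (m%:R + 1) * d) = m%:R * d ^+ 2 by ring.
  by rewrite mulr_ge0// sqr_ge0.
have [n hn] : exists n : nat, K / d < n%:R.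
  exists (Num.bound `|K / d|).
  exact: le_lt_trans (ler_norm _) (archi_boundP (normr_ge0 (K / d))).
have := h n; rewrite -ler_pdivrMr ?exprn_gt0// -expr_div_n => hK.
have := le_trans (bernoulli _) hK; apply/negP; rewrite -ltNge.
move: hn; rewrite ltr_pdivrMr// => /lt_le_trans; apply.
rewrite (@le_trans _ _ ((2 ^ n)%:R * d))//; last by rewrite lerDr.
by rewrite ler_wpM2r ?(ltW d0)// ler_nat ltnW// ltn_expl.
Qed.

Variables (A B : cstarAlgType R) (f : {lrmorphism A -> B}).
Hypothesis fs : star_preserving f.

(** The crude bound is applied to the powers [h ^+ (2 ^ n)] of [h = star a * a], whose norms are
    exact powers of [cnorm h]; [K] then disappears. *)
Lemma star_morph_contractive K : (forall a, cnorm (f a) <= K * cnorm a) ->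
  forall a, cnorm (f a) <= cnorm a.
Proof.
move=> fK a; rewrite -(@ler_pXn2r _ 2) ?nnegrE ?cnorm_ge0// -!cnorm_starM.
rewrite -fs -rmorphM; set h := star a * a.
have hs : star h = h by rewrite starM starK.
have fhs : star (f h) = f h by rewrite -fs hs.
apply: (@ler_exp2n_bound _ _ K); rewrite ?cnorm_ge0// => n.
rewrite -(cnorm_sa_exp n fhs) -(cnorm_sa_exp n hs) -rmorphXn; exact: fK.
Qed.

Lemma star_morph_expansive K : (forall a, cnorm a <= K * cnorm (f a)) ->
  forall a, cnorm a <= cnorm (f a).
Proof.
move=> fK a; rewrite -(@ler_pXn2r _ 2) ?nnegrE ?cnorm_ge0// -!cnorm_starM.
rewrite -fs -rmorphM; set h := star a * a.
have hs : star h = h by rewrite starM starK.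
have fhs : star (f h) = f h by rewrite -fs hs.
apply: (@ler_exp2n_bound _ _ K); rewrite ?cnorm_ge0// => n.
rewrite -(cnorm_sa_exp n fhs) -(cnorm_sa_exp n hs) -rmorphXn; exact: fK.
Qed.

End power_trick.

Section matrix_isometry.
Variables (R : realType) (k : nat) (A : cstarAlgType R).
Variable f : {lrmorphism 'M[R[i]]_k.+1 -> A}.
Hypothesis fs : star_preserving f.
Local Notation M := 'M[R[i]]_k.+1.
Local Notation e i j := (delta_mx i j : M).

Let fZ (c : R[i]) (a : M) : f (c *: a) = c *: f a.
Proof. exact: linearZ. Qed.

Let fsum I (r : seq I) (F : I -> M) : f (\sum_(i <- r) F i) = \sum_(i <- r) f (F i).
Proof. exact: raddf_sum. Qed.

Let fM (a b : M) : f (a * b) = f a * f b.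
Proof. exact: rmorphM. Qed.

Lemma cnorm_sum I (r : seq I) (F : I -> A) :
  cnorm (\sum_(i <- r) F i) <= \sum_(i <- r) cnorm (F i).
Proof.
elim: r => [|i r IH]; first by rewrite !big_nil cnorm0.
by rewrite !big_cons (le_trans (cnormD _ _))// lerD2l.
Qed.

(** Crude bounds in both directions suffice by the power trick. The upper one expands [a] in matrix
    units. The lower one recovers each entry from [e 0 i * a * e j 0 = a i j *: e 0 0], where
    [f (e 0 0)] is nonzero because every matrix unit factors through [e 0 0] and [f 1 = 1]. *)
Lemma matrix_isometry (x : M) : cnorm (f x) = cnorm x.
Proof.
apply/eqP; rewrite eq_le; apply/andP; split.
  pose K := \sum_i \sum_j cnorm (f (e i j)).
  apply: (star_morph_contractive fs (K := K)) => a.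
  rewrite [in leLHS](matrix_sum_delta a) fsum (le_trans (cnorm_sum _ _))//.
  rewrite mulr_suml; apply: ler_sum => i _.
  rewrite fsum (le_trans (cnorm_sum _ _))// mulr_suml; apply: ler_sum => j _.
  by rewrite fZ cnormZ mulrC ler_wpM2l ?cnorm_ge0// normc_opnorm.
have n0 : 0 < cnorm (f (e 0 0)).
  rewrite lt_def cnorm_ge0 andbT; apply/eqP => /cnorm0_eq0 f0.
  have : f (e 0 0 * 0 + 1) = 0.
    rewrite mulr0 add0r (matrix_sum_delta (1 : M)).
    rewrite fsum big1// => i _; rewrite fsum big1// => j _.
    have -> : e i j = e i 0 * e 0 0 * e 0 j.
      by rewrite -![_ * _]/(_ *m _) !mul_delta_mx.
    by rewrite fZ !fM f0 mulr0 mul0r scaler0.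
  by rewrite mulr0 add0r rmorph1 => /eqP; rewrite oner_eq0.
pose K := \sum_i \sum_j (cnorm (f (e 0 i)) * cnorm (f (e j 0)) / cnorm (f (e 0 0))).
apply: (star_morph_expansive fs (K := K)) => a.
rewrite (le_trans (opnorm_le_sum a))// /sumnorm mulr_suml; apply: ler_sum => i _.
rewrite mulr_suml; apply: ler_sum => j _.
rewrite mulrAC ler_pdivlMr// -cnormZ -fZ.
have -> : a i j *: e 0 0 = e 0 i * a * e j 0.
  rewrite -(mul_delta_mx (0 : 'I_1) 0 i) -(mul_delta_mx (0 : 'I_1) j 0).
  rewrite -![_ * _]/(_ *m _) !mulmxA -[_ *m _ *m a]mulmxA -rowE.
  rewrite -[_ *m _ *m delta_mx j 0]mulmxA -colE.
  have -> : col j (row i a) = (a i j)%:M.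
    by apply/matrixP => p q; rewrite !ord1 !mxE eqxx mulr1n.
  by rewrite mul_mx_scalar -scalemxAl mul_delta_mx.
rewrite !fM (le_trans (cnormM _ _))// mulrAC ler_wpM2r ?cnorm_ge0//.
exact: cnormM.
Qed.

End matrix_isometry.

(** * Levels of UHF algebras *)

(** Traciality kills the off-diagonal matrix units and gives all diagonal ones the same value, which
    normalisation fixes. *)
Lemma tracial_matrix (R : realType) k (tau : state ('M[R[i]]_k.+1 : cstarAlgType R)) :
  (forall a b, tau (a * b) = tau (b * a)) ->
  forall x : 'M[R[i]]_k.+1, tau x = \tr x / k.+1%:R.
Proof.
move=> tauC; pose e i j := (delta_mx i j : 'M[R[i]]_k.+1).
have eM i j p : e i j * e j p = e i p by rewrite -[_ * _]/(_ *m _) mul_delta_mx.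
have e0 i j : i != j -> tau (e i j) = 0.
  move=> ij; rewrite -(eM i i j) tauC -[_ * _]/(_ *m _) mul_delta_mx_cond.
  by rewrite eq_sym (negPf ij) mulr0n; exact: (raddf0 tau).
have ee i : tau (e i i) = tau (e 0 0) by rewrite -(eM i 0 i) tauC eM.
have tauE (x : 'M[R[i]]_k.+1) : tau x = \tr x * tau (e 0 0).
  rewrite {1}(matrix_sum_delta x) (raddf_sum tau) mulr_suml.
  apply: eq_bigr => i _; rewrite (raddf_sum tau) (bigD1 i)//= big1 ?addr0.
    by rewrite stateZ -[delta_mx i i]/(e i i) ee.
  by move=> j ji; rewrite stateZ e0 ?mulr0// eq_sym.
move=> x; rewrite tauE; congr (_ * _).
have := state1 tau; rewrite tauE mxtrace1 => h.
by apply: (mulfI (x := k.+1%:R)); rewrite ?h ?divff// pnatr_eq0.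
Qed.

(** * Moving matrices between propositionally equal sizes *)

Section transport.
Variable R : realType.
Local Notation M k := ('M[R[i]]_k.+1).

(** Reindexing entries needs no proof of [k = k'] in the term, so casts at different levels compose
    freely; eliminating the equality reduces each property to [castM_id]. *)
Definition castM k k' (x : M k) : M k' := \matrix_(i, j) x (inord i) (inord j).

Lemma castM_id k (x : M k) : castM k x = x.
Proof. by apply/matrixP => i j; rewrite !mxE !inord_val. Qed.

Variables (k k' : nat) (kk' : k = k').

Lemma castMK (x : M k') : castM k' (castM k x) = x.
Proof. by case: _ / kk' x => x; rewrite !castM_id. Qed.

Lemma castM_mul (x y : M k) : castM k' (x * y) = castM k' x * castM k' y.
Proof. by case: _ / kk'; rewrite !castM_id. Qed.

Lemma castMB (x y : M k) : castM k' (x - y) = castM k' x - castM k' y.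
Proof. by case: _ / kk'; rewrite !castM_id. Qed.

Lemma castM_star (x : M k) : castM k' (star x) = star (castM k' x).
Proof. by case: _ / kk'; rewrite !castM_id. Qed.

Lemma castM_norm (x : M k) : cnorm (castM k' x) = cnorm x.
Proof. by case: _ / kk'; rewrite !castM_id. Qed.

Lemma castM_trace (x : M k) : \tr (castM k' x) / k'.+1%:R = \tr x / k.+1%:R.
Proof. by case: _ / kk'; rewrite !castM_id. Qed.

Lemma lipPair_castM (l : M k -> R) (l' : M k' -> R) :
  (forall x, l' (castM k' x) = l x) ->
  @LipPair R (M k) (@selfadjoint R (M k)) l =
  @LipPair R (M k') (@selfadjoint R (M k')) l'.
Proof.
case: _ / kk' l' => l' h; congr LipPair; apply/funext => x.
by rewrite -h castM_id.
Qed.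

End transport.

Lemma castM_diag (R : realType) (beta eta : baire) n :
  boxtimes beta n = boxtimes eta n -> boxtimes beta n.+1 = boxtimes eta n.+1 ->
  forall a : uhf_mx R beta n,
  castM _ (diag_copies a) = diag_copies (castM _ a : uhf_mx R eta n).
Proof.
rewrite /uhf_mx /diag_copies => e1 e2.
case: _ / e1; case: _ / e2 => a.
by rewrite !castM_id.
Qed.

Section same_level.
Variables (R : realType) (beta eta : baire) (N : nat).
Hypothesis beta_eta : forall j, (j < N)%N -> beta j = eta j.

Lemma same_boxtimes n : (n <= N)%N -> boxtimes beta n = boxtimes eta n.
Proof. by move=> nN; apply: eq_bigr => j _; rewrite beta_eta// (leq_trans _ nN). Qed.

Lemma same_gamma n : (n <= N)%N -> gamma R beta n = gamma R eta n.
Proof. by move=> nN; rewrite /gamma same_boxtimes. Qed.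

Let c n : uhf_mx R beta n -> uhf_mx R eta n := castM _.

Let same_pred n : (n <= N)%N -> (boxtimes beta n).-1 = (boxtimes eta n).-1.
Proof. by move=> nN; rewrite same_boxtimes. Qed.

Variables (A A' : cstarAlgType R).
Variables (mu : forall n, {lrmorphism uhf_mx R beta n -> A})
  (mu' : forall n, {lrmorphism uhf_mx R eta n -> A'}).
Hypotheses (mu_lim : inductive_limit mu) (mu'_lim : inductive_limit mu').
Variables (rho : state A) (rho' : state A').
Hypotheses (rho_tr : faithful_tracial rho) (rho'_tr : faithful_tracial rho').
Variables (E : nat -> {linear A -> A}) (E' : nat -> {linear A' -> A'}).
Hypotheses (E_ce : forall m, conditional_expectation (range (mu m)) (E m))
  (E'_ce : forall m, conditional_expectation (range (mu' m)) (E' m)).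
Hypotheses (E_rho : forall m, preserves rho (E m))
  (E'_rho : forall m, preserves rho' (E' m)).

Let muB n x y : mu n (x - y) = mu n x - mu n y. Proof. exact: raddfB. Qed.
Let mu'B n x y : mu' n (x - y) = mu' n x - mu' n y. Proof. exact: raddfB. Qed.
Let muM n x y : mu n (x * y) = mu n x * mu n y. Proof. exact: rmorphM. Qed.
Let mu'M n x y : mu' n (x * y) = mu' n x * mu' n y. Proof. exact: rmorphM. Qed.
Let mus n x : mu n (star x) = star (mu n x). Proof. exact: limit_star. Qed.
Let mu's n x : mu' n (star x) = star (mu' n x). Proof. exact: limit_star. Qed.

Lemma trace_transport n (x : uhf_mx R beta n) : (n <= N)%N ->
  rho' (mu' n (c x)) = rho (mu n x).
Proof.
move=> nN.
have h' : rho' (mu' n (c x)) = \tr (c x) / (boxtimes eta n).-1.+1%:R.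
  apply: (@tracial_matrix R _ (pullback (@limit_star _ _ _ _ mu'_lim n) rho')) => a b.
  by rewrite /= /pullback_fun !mu'M rho'_tr.2.
have h : rho (mu n x) = \tr x / (boxtimes beta n).-1.+1%:R.
  apply: (@tracial_matrix R _ (pullback (@limit_star _ _ _ _ mu_lim n) rho)) => a b.
  by rewrite /= /pullback_fun !muM rho_tr.2.
by rewrite h' h castM_trace//; exact: same_pred.
Qed.

(** Iterated [diag_copies] commutes with the cast, so one matrix [z] represents [y] at level [n] in
    both limits simultaneously. *)
Lemma level_embed m n (y : uhf_mx R beta m) : (m <= n)%N -> (n <= N)%N ->
  exists z : uhf_mx R beta n, mu m y = mu n z /\ mu' m (c y) = mu' n (c z).
Proof.
elim: n => [|n IH] in y *.
  by rewrite leqn0 => /eqP m0 _; case: _ / m0 in y *; exists y.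
rewrite leq_eqVlt => /orP[/eqP mn|mn] nN; first by case: _ / mn in y *; exists y.
have [z [zE z'E]] := IH y mn (ltnW nN); exists (diag_copies z).
rewrite limit_compat// zE z'E; split => //; rewrite -limit_compat//; congr (mu' _ _).
by rewrite /c castM_diag// same_boxtimes// ltnW.
Qed.

(** A trace-preserving expectation is determined by the pairings of its values with level [m], the
    trace being faithful. These pairings are traces of matrices at level [n], which agree for both
    limits. *)
Lemma condexp_transport m n (x : uhf_mx R beta n) : (m <= n)%N -> (n <= N)%N ->
  exists y : uhf_mx R beta m, E m (mu n x) = mu m y /\ E' m (mu' n (c x)) = mu' m (c y).
Proof.
move=> mn nN; have mN := leq_trans mn nN.
have [y _ yE] := condexp_im (E_ce m) (mu n x).
have [w _ wE] := condexp_im (E'_ce m) (mu' n (c x)).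
exists y; split => //; rewrite -wE; apply/eqP; rewrite -subr_eq0; apply/eqP.
apply: rho'_tr.1; rewrite -mu'B -mu's.
(* Pairing the discrepancy with its own adjoint, seen from the [beta] side. *)
pose z : uhf_mx R beta m := castM _ (star (w - c y)).
have zE : c z = star (w - c y) by rewrite /c castMK//; exact: same_pred.
rewrite -zE mu'B mulrBr (raddfB rho') /=; apply/eqP; rewrite subr_eq0; apply/eqP.
have [z' [zz' czz']] := level_embed z mn nN.
(* The bimodule law with right factor 1 moves [z] inside the expectation, which the trace then
   absorbs. *)
rewrite wE -[mu' m (c z) * _]mulr1 -(condexp_bimod (E'_ce m)); last 2 first.
- by exists (c z).
- by exists 1 => //; exact: rmorph1.
rewrite mulr1 (E'_rho m).
have cM k (a b : uhf_mx R beta k) : (k <= N)%N ->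
    mu' k (c a) * mu' k (c b) = mu' k (c (a * b)).
  by move=> kN; rewrite -mu'M /c castM_mul//; exact: same_pred.
rewrite cM// trace_transport// czz' cM// trace_transport// !muM -zz' yE.
rewrite -(E_rho m) -[_ * mu n x]mulr1 (condexp_bimod (E_ce m)) ?mulr1//.
by exists 1 => //; exact: rmorph1.
Qed.

(** The element under the norm lies at level [m], where [matrix_isometry] reduces both norms to the
    operator norm of the same matrix. *)
Lemma condexp_norm_transport m n (x : uhf_mx R beta n) : (m <= n)%N -> (n <= N)%N ->
  condexp_norm (E' m) (mu' n (c x) - E' m (mu' n (c x))) =
  condexp_norm (E m) (mu n x - E m (mu n x)).
Proof.
move=> mn nN; have mN := leq_trans mn nN.
have [y [-> ->]] := condexp_transport x mn nN.
have [z [-> ->]] := level_embed y mn nN.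
rewrite /condexp_norm -muB -mu'B -mus -mu's -muM -mu'M.
have -> : star (c x - c z) * (c x - c z) = c (star (x - z) * (x - z)).
  by rewrite /c castM_mul ?castM_star ?castMB//; exact: same_pred.
have [v [-> ->]] := condexp_transport (star (x - z) * (x - z)) mn nN.
congr Num.sqrt; rewrite (matrix_isometry (@limit_star _ _ _ _ mu_lim m)).
rewrite (matrix_isometry (@limit_star _ _ _ _ mu'_lim m)).
by rewrite castM_norm//; exact: same_pred.
Qed.

Lemma uhf_level_eq (lambda lambda' : nat -> R) :
  (forall n, (n < N)%N -> lambda n = lambda' n) ->
  uhf_level lambda E mu N = uhf_level lambda' E' mu' N.
Proof.
move=> ll'; apply: lipPair_castM; first exact: same_pred.
move=> x; apply: eq_bigr => m _; have mN := ltn_ord m.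
rewrite ll'// same_gamma; last exact: ltnW.
rewrite -mus -mu's -/(c x).
have -> : star (c x) = c (star x) by rewrite /c castM_star//; exact: same_pred.
by rewrite !condexp_norm_transport// ltnW.
Qed.

End same_level.

(** * Continuity *)

Lemma boxtimes_ge (beta : baire) n : (2 ^ n <= boxtimes beta n)%N.
Proof.
elim: n => [|n IH]; first by rewrite /boxtimes big_ord0.
rewrite /boxtimes big_ord_recr /= expnSr leq_mul//.
by rewrite ltnS; exact: valP (beta n).
Qed.

(** The dimension is the square of [boxtimes beta n], and one factor is already at least [2 ^ n]. *)
Lemma gamma_le (R : realType) (beta : baire) n : gamma R beta n <= 2^-1 ^+ n.
Proof.
rewrite /gamma dimvf /dim /= exprVn lef_pV2 ?posrE ?exprn_gt0//; last first.
  by rewrite ltr0n muln_gt0 boxtimes_gt0.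
rewrite -natrX ler_nat (leq_trans (boxtimes_ge beta n))//.
by rewrite leq_pmulr// boxtimes_gt0.
Qed.

Lemma gamma_ge0 (R : realType) (beta : baire) n : 0 <= gamma R beta n.
Proof. by rewrite invr_ge0. Qed.

Lemma geometric_partial_sum (R : realType) N n :
  \sum_(N <= j < n) (2^-1 : R) ^+ j <= 2 * 2^-1 ^+ N.
Proof.
have h k : \sum_(N <= j < N + k) (2^-1 : R) ^+ j = 2 * 2^-1 ^+ N - 2 * 2^-1 ^+ (N + k).
  elim: k => [|k IH]; first by rewrite addn0 big_geq// subrr.
  rewrite addnS big_nat_recr ?leq_addr//= IH exprS.
  by field.
have [nN|/ltnW Nn] := leqP n N; first by rewrite big_geq// mulr_ge0// exprn_ge0.
by rewrite -(subnKC Nn) h gerBl mulr_ge0// exprn_ge0.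
Qed.

Lemma gamma_tail (R : realType) (beta : baire) N :
  (\sum_(N <= j <oo) (gamma R beta j)%:E <= (2 * 2^-1 ^+ N)%:E)%E.
Proof.
apply: lime_le.
  by apply: is_cvg_nneseries => n _ _; rewrite lee_fin gamma_ge0.
apply: nearW => n; rewrite sumEFin lee_fin.
rewrite (le_trans _ (geometric_partial_sum R N n))//.
by apply: ler_sum => j _; exact: gamma_le.
Qed.

Lemma exists_half_pow_lt (R : realType) (e : R) : 0 < e ->
  exists N, (2^-1 : R) ^+ N < e.
Proof.
move=> e0; exists (Num.bound e^-1).
rewrite exprVn -ltf_pV2 ?posrE ?invr_gt0 ?exprn_gt0// invrK -natrX.
rewrite (lt_le_trans (archi_boundP _))// ?invr_ge0 ?(ltW e0)//.
by rewrite ler_nat ltnW// ltn_expl.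
Qed.

Lemma baire_dist_lt (R : realType) (beta eta : baire) N :
  baire_dist R beta eta < 2^-1 ^+ N -> forall j, (j < N)%N -> beta j = eta j.
Proof.
rewrite /baire_dist; case: pselect => [ex|nex]; last first.
  by move=> _ j _; apply/eqP/negP => h; apply: nex; exists j; apply/negP.
case: ex_minnP => m _ mmin; rewrite !exprVn ltf_pV2 ?posrE ?exprn_gt0//.
rewrite ltr_eXn2l ?ltr1n// => Nm j jN; apply/eqP/negP => /negP/mmin.
by rewrite leqNgt (ltn_trans jN Nm).
Qed.

Theorem theorem3p12 (R : realType)
  (rhoM : forall (beta : baire) n, state (uhf_mx R beta n))
  (rhoM_tracial : forall beta n, faithful_tracial (rhoM beta n))
  (EM : forall (beta : baire) n,
      {linear uhf_mx R beta n.+1 -> uhf_mx R beta n.+1})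
  (EM_condexp : forall beta n,
      [/\ conditional_expectation (range (@diag_copies R beta n)) (EM beta n),
          faithful (EM beta n) & preserves (rhoM beta n.+1) (EM beta n)])
  (lambda : baire -> nat -> R)
  (lambda_gt0 : forall beta n, 0 < lambda beta n)
  (lambda_le : forall beta n (a : uhf_mx R beta n.+1),
      lambda beta n * cnorm a <= condexp_norm (EM beta n) a)
  (lambda_dep : forall beta eta n,
      boxtimes beta n.+1 = boxtimes eta n.+1 -> lambda beta n = lambda eta n)
  (uhf : baire -> cstarAlgType R)
  (mu : forall beta n, {lrmorphism uhf_mx R beta n -> uhf beta})
  (uhf_limit : forall beta, inductive_limit (mu beta))
  (rho : forall beta, state (uhf beta))
  (rho_tracial : forall beta, faithful_tracial (rho beta))
  (E : forall beta, nat -> {linear uhf beta -> uhf beta})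
  (E_condexp : forall beta m,
      [/\ conditional_expectation (range (mu beta m)) (E beta m),
          faithful (E beta m) & preserves (rho beta) (E beta m)])
  (dom : forall beta, set (uhf beta))
  (L : forall beta, uhf beta -> R)
  (L_qcms : forall beta, is_qcms (LipPair (dom beta) (@L beta)))
  (L_SL : forall beta, strongly_leibniz (LipPair (dom beta) (@L beta)))
  (L_approx : forall beta n,
      (propinquity_SL (uhf_level (lambda beta) (E beta) (mu beta) n)
                      (LipPair (dom beta) (@L beta))
       <= 4%:E * \sum_(n <= j <oo) (gamma R beta j)%:E)%E) :
  forall (beta : baire) (e : R), 0 < e ->
    exists2 d : R, 0 < d &
      forall eta : baire, baire_dist R beta eta < d ->
        (propinquity_SL (LipPair (dom beta) (@L beta))
                        (LipPair (dom eta) (@L eta)) < e%:E)%E.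
Proof.
move=> beta e e0; have e4 : 0 < e / 4 by rewrite divr_gt0.
(* [8 / 2^N < e / 4]: each limit is within [e / 4] of its level, and gluing with parameter [e / 4]
   brings the total to [3 e / 4]. *)
have [N NP] := exists_half_pow_lt (divr_gt0 e4 (ltr0Sn R 7)).
exists (2^-1 ^+ N) => [|eta /baire_dist_lt beta_eta]; first by rewrite exprn_gt0.
have near (b : baire) : (propinquity_SL
    (uhf_level (lambda b) (E b) (mu b) N) (LipPair (dom b) (@L b)) < (e / 4)%:E)%E.
  apply: le_lt_trans (L_approx b N) _.
  apply: (@le_lt_trans _ _ (4%:E * (2 * 2^-1 ^+ N)%:E)%E).
    by apply: lee_wpmul2l; [rewrite lee_fin|exact: gamma_tail].
  rewrite -EFinM lte_fin; move: NP; rewrite ltr_pdivlMr// => NP.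
  by rewrite mulrA (_ : 4 * 2 = 8 :> R) 1?mulrC//; ring.
have level_eq : uhf_level (lambda eta) (E eta) (mu eta) N =
    uhf_level (lambda beta) (E beta) (mu beta) N.
  apply/esym; apply: (uhf_level_eq beta_eta (uhf_limit beta) (uhf_limit eta)
    (rho_tracial beta) (rho_tracial eta)).
  - by move=> m; case: (E_condexp beta m).
  - by move=> m; case: (E_condexp eta m).
  - by move=> m; case: (E_condexp beta m).
  - by move=> m; case: (E_condexp eta m).
  (* The constant of index [n] depends on the size at level [n + 1], which is still at most [N]. *)
  - by move=> n nN; apply: lambda_dep; exact: (same_boxtimes beta_eta).
have [_ [t1 t1_SL ->] t1_lt] := ereal_inf_lt (near beta).
have := near eta; rewrite level_eq => /ereal_inf_lt[_ [t2 t2_SL ->] t2_lt].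
(* The trace of level [N] serves as the reference state [phiB]. *)
apply: le_lt_trans (propinquity_glue (rhoM beta N : state (uhf_level _ _ _ _))
  _ t1_SL t2_SL t1_lt t2_lt (ltW e4) (ltW e4) e4) _.
  by move=> A f fs; exact: matrix_contractive.
by rewrite lte_fin; lra.
Qed.
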